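(* Let $\alpha>1$, $m_0\in\mathcal P_\alpha(\mathbb R^d)$, $R\ge R(\alpha,[m_0]_\alpha)$. Assume that there exist constants $w_L,w_G\ge0$ such that for all $\lambda\in[0,1]$, all $r>0$, all $u\in\mathbb R^k$, all $x_0,x_1\in B_r$ and all $m\in\mathcal P_1(\mathbb R^d)$, $$\lambda L(x_0,u,m)+(1-\lambda)L(x_1,u,m)-L(\lambda x_0+(1-\lambda)x_1,u,m)\le w_L\lambda(1-\lambda)|x_0-x_1|^2,$$ $$\lambda G(x_0,m)+(1-\lambda)G(x_1,m)-G(\lambda x_0+(1-\lambda)x_1,m)\le w_G\lambda(1-\lambda)|x_0-x_1|^2.$$ Let $\eta\in\mathcal P_{m_0}(\Gamma_T,R)$ be a Lipschitz Mean Field Games equilibrium for $m_0$, and let $(V,m^\eta)$ be the mild solution associated with $\eta$. Then $V$ is locally semiconcave on $[0,T]\times\mathbb R^d$ with a linear modulus of semiconcavity; that is, for every $\rho>0$ there is $\Lambda\ge0$ such that $$V(t+\delta,x+h)+V(t-\delta,x-h)-2V(t,x)\le\Lambda\big(|h|^2+|\delta|^2\big)$$ whenever $(t,x),(t+\delta,x+h),(t-\delta,x-h)\in[0,T]\times\overline B_\rho$.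
   Context: $B_r$ is the open ball of radius $r$ centered at $0$ in $\mathbb R^d$. Data: $T>0$; real matrices $A$ ($d\times d$) and $B$ ($d\times k$). $\mathcal P_p(\mathbb R^d)$ is the set of Borel probability measures on $\mathbb R^d$ with finite $p$-th moment and $d_1$ is the Kantorovich–Rubinstein (1-Wasserstein) distance. $L:\mathbb R^d\times\mathbb R^k\times\mathcal P_1(\mathbb R^d)\to\mathbb R$ and $G:\mathbb R^d\times\mathcal P_1(\mathbb R^d)\to\mathbb R$ satisfy the standing assumptions: (1) for each $m$, $(x,u)\mapsto L(x,u,m)$ is $C^2$, and $m\mapsto L(x,u,m)$ is $d_1$-Lipschitz with a constant independent of $(x,u)$; (2) $G$ is bounded and uniformly continuous on $\mathbb R^d\times\mathcal P_1(\mathbb R^d)$, and for each $m$, $x\mapsto G(x,m)$ is in $C^1_b(\mathbb R^d)$ (bounded with bounded uniformly continuous first derivatives); (3) there are constants $C_0>0$, $C_1,C_2\ge0$ such that for all $(x,u,m)$: $\frac{1}{C_0}\mathrm{Id}\le D^2_{uu}L(x,u,m)\le C_0\mathrm{Id}$, $\|D^2_{xu}L(x,u,m)\|\le C_1(1+|u|)$, and $|L(x,0,m)|+|D_xL(x,0,m)|+|D_uL(x,0,m)|\le C_2$. For $x\in\mathbb R^d$ and $u\in L^1(0,T;\mathbb R^k)$, $\gamma(\cdot;x,u)$ is the solution of $\dot\gamma=A\gamma+Bu$ on $[0,T]$, $\gamma(0)=x$. $\Gamma_T$ is the set of all such curves, with the uniform norm, and $e_t(\gamma)=\gamma(t)$.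 Let $[m_0]_\alpha=\int|x|^\alpha\,m_0(dx)$. For $R\ge[m_0]_\alpha$, $$\mathcal P_{m_0}(\Gamma_T,R)=\Big\{\eta\in\mathcal P(\Gamma_T):\int_{\Gamma_T}\|\dot\gamma\|_{2}^\alpha\,\eta(d\gamma)\le R,\ e_0\sharp\eta=m_0\Big\},$$ where $\|\cdot\|_2$ is the $L^2(0,T)$ norm. For $\eta$ in this set, let $m^\eta_t=e_t\sharp\eta$, $J_\eta(x,u)=\int_0^TL(\gamma(t;x,u),u(t),m^\eta_t)\,dt+G(\gamma(T;x,u),m^\eta_T)$, and let $\Gamma^*_\eta(x)$ be the set of curves $\gamma(\cdot;x,u^* )$ where $u^*$ minimizes $J_\eta(x,\cdot)$ over $L^2(0,T;\mathbb R^k)$. A Mean Field Games equilibrium for $m_0$ is an $\eta\in\mathcal P_{m_0}(\Gamma_T,R)$ with $\operatorname{supp}(\eta)\subset\bigcup_{x\in\mathbb R^d}\Gamma^*_\eta(x)$; it is called Lipschitz if $\sup_{t\neq s}\frac{d_1(m^\eta_t,m^\eta_s)}{|t-s|}<\infty$. The mild solution associated with $\eta$ is the pair $(V,m^\eta)$ with $$V(t,x)=\inf_{u\in L^2(t,T;\mathbb R^k)}\Big\{\int_t^TL(\gamma(s;t,x,u),u(s),m^\eta_s)\,ds+G(\gamma(T;t,x,u),m^\eta_T)\Big\},$$ where $\gamma(\cdot;t,x,u)$ solves $\dot\gamma=A\gamma+Bu$ on $[t,T]$, $\gamma(t)=x$. $R(\alpha,[m_0]_\alpha)\ge[m_0]_\alpha$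 denotes a positive constant such that, for every $R\ge R(\alpha,[m_0]_\alpha)$, the set $\mathcal P_{m_0}(\Gamma_T,R)$ is non-empty and for every $\eta$ in it there is $\nu\in\mathcal P_{m_0}(\Gamma_T,R)$ whose disintegration $\nu(d\gamma)=\int\nu_x(d\gamma)m_0(dx)$ with respect to $e_0$ satisfies $\operatorname{supp}(\nu_x)\subset\Gamma^*_\eta(x)$ for $m_0$-a.e. $x$ (such a constant exists). *)

(* Defs.v *)
From HB Require Import structures.
From mathcomp Require Import all_boot all_order all_algebra.
From mathcomp Require Import all_classical all_reals all_analysis.

Set Implicit Arguments.
Unset Strict Implicit.
Unset Printing Implicit Defensive.
Import Order.TTheory GRing.Theory Num.Theory.
Import numFieldNormedType.Exports.

Local Open Scope classical_set_scope.
Local Open Scope ring_scope.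

Definition borel (X : ptopologicalType) : Type := g_sigma_algebraType (@open X).

HB.instance Definition _ (X : ptopologicalType) := Measurable.on (borel X).

(* The library norm on matrices is the max norm (same topology). *)
Definition enorm (R : realType) (n : nat) (v : 'cV[R]_n) : R :=
  Num.sqrt (\sum_(i < n) v i 0 ^+ 2).

Definition opnorm (R : realType) (m n : nat) (M : 'M[R]_(m, n)) : R :=
  sup [set enorm (M *m v) | v in [set v : 'cV[R]_n | enorm v <= 1]].

Definition loewner_le (R : realType) (n : nat) (M N : 'M[R]_n) : Prop :=
  forall v : 'cV[R]_n, (v^T *m M *m v) 0 0 <= (v^T *m N *m v) 0 0.

(* In finite dimension, continuity of every ['D_v f] is continuity of the
   differential. *)
Definition is_C1 (R : realType) (V : normedModType R) (f : V -> R) : Prop :=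
  (forall z, differentiable f z) /\ (forall v, continuous ('D_v f)).

Definition is_C2 (R : realType) (V : normedModType R) (f : V -> R) : Prop :=
  is_C1 f /\ (forall v, is_C1 ('D_v f)).

Definition grad (R : realType) (n : nat) (g : 'cV[R]_n -> R)
    (x : 'cV[R]_n) : 'cV[R]_n :=
  \col_i 'D_(delta_mx i 0) g x.

Definition is_C1b (R : realType) (n : nat) (g : 'cV[R]_n -> R) : Prop :=
  [/\ is_C1 g,
      exists M, forall x, `|g x| <= M,
      exists M, forall x, enorm (grad g x) <= M &
      unif_continuous (grad g)].

Section partial_derivatives.
Variables (R : realType) (d k : nat).
Implicit Types (f : 'cV[R]_d * 'cV[R]_k -> R) (z : 'cV[R]_d * 'cV[R]_k).

Definition dirx (i : 'I_d) : 'cV[R]_d * 'cV[R]_k := (delta_mx i 0, 0).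
Definition diru (j : 'I_k) : 'cV[R]_d * 'cV[R]_k := (0, delta_mx j 0).

Definition gradx f z : 'cV[R]_d := \col_i 'D_(dirx i) f z.
Definition gradu f z : 'cV[R]_k := \col_j 'D_(diru j) f z.
Definition hessuu f z : 'M[R]_k :=
  \matrix_(i, j) 'D_(diru i) ('D_(diru j) f) z.
Definition hessxu f z : 'M[R]_(d, k) :=
  \matrix_(i, j) 'D_(dirx i) ('D_(diru j) f) z.

End partial_derivatives.

Section wasserstein.
Variables (R : realType) (d : nat).
Local Notation E := (borel 'cV[R]_d).
Implicit Types m : probability E R.
Local Open Scope ereal_scope.

Definition moment (p : R) m : \bar R := \int[m]_x ((enorm x) `^ p)%:E.

Definition finite_moment (p : R) m : Prop := moment p m < +oo.

Definition is_coupling m m' (pi : probability (E * E)%type R) : Prop :=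
  forall D : set E, measurable D ->
    pi (D `*` setT) = m D /\ pi (setT `*` D) = m' D.

(* Finite on measures with finite first moment. *)
Definition d1 m m' : \bar R :=
  ereal_inf [set \int[pi]_z (enorm (z.1 - z.2)%R)%:E
            | pi in is_coupling m m'].

End wasserstein.

Section assumptions.
Variables (R : realType) (d k : nat).
Local Notation E := (borel 'cV[R]_d).
Variable L : 'cV[R]_d -> 'cV[R]_k -> probability E R -> R.
Variable G : 'cV[R]_d -> probability E R -> R.

(* [L] and [G] are only constrained on measures with finite first moment:
   their values at other measures are irrelevant. *)

Record running_cost_assumptions : Prop := {
  running_C2 : forall m, finite_moment 1 m ->
    is_C2 (fun z : 'cV[R]_d * 'cV[R]_k => L z.1 z.2 m) ;
  running_lipschitz : exists2 K : R, 0 <= K &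
    forall x u m m', finite_moment 1 m -> finite_moment 1 m' ->
      (`|L x u m - L x u m'|%:E <= K%:E * d1 m m')%E ;
  running_growth : exists C0 C1 C2 : R,
    [/\ 0 < C0, 0 <= C1, 0 <= C2 &
      forall x u m, finite_moment 1 m ->
        let f := fun z : 'cV[R]_d * 'cV[R]_k => L z.1 z.2 m in
        [/\ loewner_le (C0^-1)%:M (hessuu f (x, u)),
            loewner_le (hessuu f (x, u)) C0%:M,
            opnorm (hessxu f (x, u)) <= C1 * (1 + enorm u) &
            `|L x 0 m| + enorm (gradx f (x, 0)) + enorm (gradu f (x, 0))
              <= C2]] }.

Record terminal_cost_assumptions : Prop := {
  terminal_bounded : exists M, forall x m, finite_moment 1 m -> `|G x m| <= M ;
  terminal_unif_continuous : forall e : R, 0 < e -> exists2 c : R, 0 < c &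
    forall x y m m', finite_moment 1 m -> finite_moment 1 m' ->
      enorm (x - y) < c -> (d1 m m' < c%:E)%E -> `|G x m - G y m'| < e ;
  terminal_C1b : forall m, finite_moment 1 m -> is_C1b (G ^~ m) }.

End assumptions.

Section control_system.
Variables (R : realType) (d k : nat) (A : 'M[R]_d) (B : 'M[R]_(d, k)).

(* [u] represents an element of L^p(a, b; R^k). *)
Definition is_control (p : nat) (a b : R) (u : R -> 'cV[R]_k) : Prop :=
  (forall j, measurable_fun `[a, b] (fun s => u s j 0)) /\
  (\int[lebesgue_measure]_(s in `[a, b]) (enorm (u s) ^+ p)%:E < +oo)%E.

(* Integral form of [g' = A g + B u] on [a, b], [g a = x]. *)
Definition is_trajectory (a b : R) (x : 'cV[R]_d) (u : R -> 'cV[R]_k)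
    (g : R -> 'cV[R]_d) : Prop :=
  {within `[a, b], continuous g} /\
  forall s, s \in `[a, b] ->
    g s = x + \col_i \int[lebesgue_measure]_(r in `[a, s])
                        ((A *m g r + B *m u r) i 0).

(* Curves on [0, T] are represented by their extensions to the real line that
   are constant on ]-oo, 0] and on [T, +oo[; hence uniform convergence on the
   whole line is uniform convergence on [0, T]. *)
Definition Gamma_set (T : R) : set {uniform R -> 'cV[R]_d} :=
  [set g | (exists x u, is_control 1 0 T u /\ is_trajectory 0 T x u g) /\
           forall t, g t = g (Num.min T (Num.max 0 t))].

Definition Gamma (T : R) : Type := set_type (Gamma_set T).

HB.instance Definition _ (T : R) := Topological.on (Gamma T).

End control_system.

Section control_system_instances.
Variables (R : realType) (d k : nat) (A : 'M[R]_d) (B : 'M[R]_(d, k)).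

Lemma Gamma_set0 (T : R) : Gamma_set A B T (fun=> 0).
Proof.
split=> //; exists 0, (fun=> 0); split.
- split=> [j /=|]; first exact: measurable_cst.
  rewrite integral0_eq ?ltry// => s _.
  rewrite /enorm big1 ?sqrtr0 ?expr1// => i _.
  by rewrite mxE expr0n.
- split; first by move=> x; exact: cst_continuous.
  move=> s _; rewrite add0r; apply/matrixP => i j; rewrite [LHS]mxE [RHS]mxE.
  rewrite /Rintegral integral0_eq// => r _.
  by rewrite /= !mulmx0 addr0 mxE.
Qed.

HB.instance Definition _ (T : R) := isPointed.Build (Gamma A B T)
  (exist _ (fun=> 0) (mem_set (Gamma_set0 T))).

Definition ev (T t : R) (g : borel (Gamma A B T)) : borel 'cV[R]_d := \val g t.

Lemma ev_continuous (T t : R) :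
  continuous (fun g : Gamma A B T => \val g t : 'cV[R]_d).
Proof.
move=> g; apply: (@continuous_comp (Gamma A B T) {uniform R -> 'cV[R]_d} _
  (fun g => \val g) (fun f => f t)); first exact: initial_continuous.
move=> U /=; rewrite -nbhs_entourageE => -[F eF FU].
apply/uniform_nbhs; exists F; split=> // h Fh.
by apply: FU; apply/xsectionP; exact: Fh.
Qed.

Lemma ev_measurable (T t : R) : measurable_fun setT (@ev T t).
Proof.
apply: (@measurability _ _ (borel (Gamma A B T)) (borel 'cV[R]_d) _ _
  (@open 'cV[R]_d) erefl).
move=> _ [U oU <-]; rewrite setTI; apply: sub_sigma_algebra.
by have /continuousP := @ev_continuous T t; exact.
Qed.

HB.instance Definition _ (T t : R) :=
  isMeasurableFun.Build _ _ _ _ (@ev T t) (@ev_measurable T t).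

End control_system_instances.

Section mean_field_game.
Variables (R : realType) (d k : nat) (A : 'M[R]_d) (B : 'M[R]_(d, k)) (T : R).
Local Notation E := (borel 'cV[R]_d).
Local Notation curves := (Gamma A B T).
Variable L : 'cV[R]_d -> 'cV[R]_k -> probability E R -> R.
Variable G : 'cV[R]_d -> probability E R -> R.

Definition flow (eta : probability (borel curves) R) (t : R) :
  probability E R := distribution eta (@ev R d k A B T t).

Definition cost (m : R -> probability E R) (t : R) (g : R -> 'cV[R]_d)
    (u : R -> 'cV[R]_k) : R :=
  \int[lebesgue_measure]_(s in `[t, T]) L (g s) (u s) (m s) + G (g T) (m T).

(* Under the standing assumptions this is the infimum of a nonempty set of
   reals that is bounded below. *)
Definition value (m : R -> probability E R) (t : R) (x : 'cV[R]_d) : R :=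
  inf [set c | exists u g, [/\ is_control 2 t T u,
                               is_trajectory A B t T x u g &
                               c = cost m t g u]].

Definition mild_solution (eta : probability (borel curves) R) :
    (R -> 'cV[R]_d -> R) * (R -> probability E R) :=
  (value (flow eta), flow eta).

Definition optimal_curves (eta : probability (borel curves) R)
    (x : 'cV[R]_d) : set curves :=
  [set g | exists u, [/\ is_control 2 0 T u,
     is_trajectory A B 0 T x u (\val g) &
     forall u' g', is_control 2 0 T u' -> is_trajectory A B 0 T x u' g' ->
       cost (flow eta) 0 (\val g) u <= cost (flow eta) 0 g' u']].

Definition supp (mu : set curves -> \bar R) : set curves :=
  [set g | forall U : set curves, open U -> U g -> (0 < mu U)%E].

(* The curves are absolutely continuous, so the derivative exists almost
   everywhere; the norm is infinite if it is not square integrable. *)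
Definition speed_L2 (g : curves) : \bar R :=
  ((\int[lebesgue_measure]_(s in `[0%R, T])
      (enorm (derive1 (\val g : R -> 'cV[R]_d) s) ^+ 2)%:E) `^ (2^-1))%E.

Definition admissible (alpha : R) (m0 : probability E R) (Rad : R) :
    set (probability (borel curves) R) :=
  [set eta : probability (borel curves) R | (\int[eta]_g (speed_L2 g `^ alpha) <= Rad%:E)%E /\
             forall D : set E, measurable D -> flow eta 0 D = m0 D].

Definition is_disintegration (nu : probability (borel curves) R)
    (m0 : probability E R) (kappa : R.-pker E ~> borel curves) : Prop :=
  (forall D : set (borel curves), measurable D ->
     nu D = (\int[m0]_x kappa x D)%E) /\
  {ae m0, forall x, kappa x (@ev R d k A B T 0 @^-1` [set x]) = 1%E}.

(* [R0] is an admissible choice of the constant R(alpha, [m0]_alpha). *)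
Definition is_radius_threshold (alpha : R) (m0 : probability E R) (R0 : R) :
    Prop :=
  [/\ 0 < R0, (moment alpha m0 <= R0%:E)%E &
    forall Rad, R0 <= Rad ->
      admissible alpha m0 Rad !=set0 /\
      forall eta, admissible alpha m0 Rad eta ->
        exists nu, admissible alpha m0 Rad nu /\
        exists kappa : R.-pker E ~> borel curves,
          is_disintegration nu m0 kappa /\
          {ae m0, forall x, supp (kappa x) `<=` optimal_curves eta x}].

Definition is_equilibrium (alpha : R) (m0 : probability E R) (Rad : R)
    (eta : probability (borel curves) R) : Prop :=
  admissible alpha m0 Rad eta /\
  supp eta `<=` \bigcup_x optimal_curves eta x.

Definition lipschitz_flow (eta : probability (borel curves) R) : Prop :=
  exists K : R, forall t s, t \in `[0, T] -> s \in `[0, T] -> t != s ->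
    (d1 (flow eta t) (flow eta s) <= (K * `|t - s|)%:E)%E.

End mean_field_game.

(* Main.v *)
Require Import Defs.
From HB Require Import structures.
From mathcomp Require Import all_boot all_order all_algebra.
From mathcomp Require Import all_classical all_reals all_analysis.
From mathcomp Require Import measurable_realfun.
From mathcomp Require Import ring lra.

Set Implicit Arguments.
Unset Strict Implicit.
Unset Printing Implicit Defensive.
Import Order.TTheory GRing.Theory Num.Theory.
Import numFieldNormedType.Exports.

Local Open Scope classical_set_scope.
Local Open Scope ring_scope.

(** Neither existence nor regularity of minimizers is needed.  Let [u] be
    [e]-optimal at [(t, x)], with trajectory [g], where
    [e = |h|^2 + delta^2] and [delta >= 0].  Comparing [u] with the control
    that vanishes on [[t, t + delta]] and equals [u] afterwards bounds the
    energy of [u] on [[t, t + delta]] by a multiple of [delta + e]; this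
    replaces the usual uniform bound on optimal controls.  From
    [(t + delta, x + h)] keep the control [u]; from [(t - delta, x - h)] use
    the shifted control [u (. + delta)] on [[t - delta, t]] and [u] from then on.
    The resulting trajectories are [g] (shifted by [delta] on
    [[t - delta, t]]) plus solutions of [y' = A y], so only the homogeneous
    equation has to be solved.  On [[t + delta, T]] the two corrections are
    [O(|h| + delta + e)] and their sum is [O((|h| + delta + e)^2)], so the
    semiconcavity of the costs in [x] yields the quadratic bound; on the short
    intervals the Lipschitz dependence of [L] on [x] and on time (through the
    Lipschitz flow of measures) suffices. *)

(** * Norms and integrals *)

(** Write [sg = |h| + delta + e]. With bounded energy alone, [g] could move by the order of the
    square root of [delta] on [[t, t + delta]]. An energy of order [delta + e] there makes the
    displacement [Dl = g (t + delta) - x] of order [sg], because [|u| <= 1 + |u| ^ 2]. This is still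
    of first order, and the shift of the control is there to cancel it: the competitor from
    [t - delta] gains the same [Dl] on [[t - delta, t]], so at [t + delta] its offset from [g] is
    close to [Dl - h], while the offset of the other competitor is exactly [h - Dl]. The shift also
    balances the running costs: one competitor skips [[t, t + delta]], the other pays for the
    control of that interval twice, which matches the factor 2 at [(t, x)]. There, position errors
    of order [sg] are weighted by an energy of order [sg], which is second order again. Losing a
    multiple of [e] is harmless, since [e] has the size of the bound to be proved. *)

Section vectors.
Variable R : realType.

Lemma normv_coord (n : nat) (v : 'cV[R]_n) i : `|v i 0| <= `|v|.
Proof.
by rewrite [leRHS]/Num.norm /= mx_normrE; apply/bigmax_geP; right; exists (i, 0).
Qed.

Lemma normv_le (n : nat) (v : 'cV[R]_n) (c : R) :
  0 <= c -> (forall i, `|v i 0| <= c) -> `|v| <= c.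
Proof.
move=> c0 vc; rewrite [leLHS]/Num.norm /= mx_normrE.
by apply/bigmax_leP; split=> //= -[i j] _ /=; rewrite (ord1 j).
Qed.

Lemma enorm_ge0 (n : nat) (v : 'cV[R]_n) : 0 <= enorm v.
Proof. exact: sqrtr_ge0. Qed.

Lemma sqr_enorm (n : nat) (v : 'cV[R]_n) :
  enorm v ^+ 2 = \sum_i v i 0 ^+ 2.
Proof. by rewrite sqr_sqrtr// sumr_ge0// => i _; exact: sqr_ge0. Qed.

Lemma normv_le_enorm (n : nat) (v : 'cV[R]_n) : `|v| <= enorm v.
Proof.
apply: normv_le; first exact: enorm_ge0.
move=> i; rewrite -sqrtr_sqr ler_sqrt ?sumr_ge0// => [|j _]; last exact: sqr_ge0.
by rewrite (bigD1 i)//= lerDl sumr_ge0// => j _; exact: sqr_ge0.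
Qed.

(** The sum of squares is at most [n] times the squared max norm; weakening [n] to [n ^ 2] avoids a
    square root in the constant. *)
Lemma enorm_le_normv (n : nat) (v : 'cV[R]_n) : enorm v <= n%:R * `|v|.
Proof.
rewrite -(@ler_sqr _ (enorm v)) ?nnegrE ?enorm_ge0 ?mulr_ge0// sqr_enorm.
apply: (@le_trans _ _ (\sum_(i < n) `|v| ^+ 2)).
  apply: ler_sum => i _; rewrite -(real_normK (num_real (v i 0))).
  by rewrite lerXn2r ?nnegrE ?normv_coord.
rewrite sumr_const card_ord -[leLHS]mulr_natl exprMn ler_wpM2r ?sqr_ge0//.
by rewrite -natrX ler_nat; case: n {v} => // n; rewrite -{1}[n.+1]muln1 leq_mul2l.
Qed.

Lemma mulmx_bounded (m n : nat) (M : 'M[R]_(m, n)) :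
  exists2 a : R, 0 <= a & forall v : 'cV[R]_n, `|M *m v| <= a * `|v|.
Proof.
exists (\sum_i \sum_j `|M i j|).
  by apply: sumr_ge0 => i _; apply: sumr_ge0.
move=> v; apply: normv_le => [|i].
  by rewrite mulr_ge0// sumr_ge0// => i _; apply: sumr_ge0.
rewrite mxE (le_trans (ler_norm_sum _ _ _))// (bigD1 i)//= mulrDl.
apply: (@le_trans _ _ ((\sum_j `|M i j|) * `|v|)).
  rewrite mulr_suml; apply: ler_sum => j _; rewrite normrM.
  by rewrite ler_wpM2l ?normv_coord.
rewrite lerDl mulr_ge0// sumr_ge0// => j _; exact: sumr_ge0.
Qed.

End vectors.

(** * Integrals over compact intervals: concatenation and translation *)

Section interval_integrals.
Variable R : realType.
Local Notation mu := (@lebesgue_measure R).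
Implicit Types (a b c : R) (f g : R -> R).

Definition itv_integrable a b f := mu.-integrable `[a, b] (EFin \o f).
Local Notation int a b f := (Rintegral mu [set` `[a, b]] f).

Lemma itg_eq a b f g : (forall s, a <= s <= b -> f s = g s) ->
  itv_integrable a b f -> itv_integrable a b g.
Proof.
move=> fg; apply: eq_integrable => //= s; rewrite inE/= in_itv/= => sab.
by rewrite fg.
Qed.

Lemma int_eq a b f g : (forall s, a <= s <= b -> f s = g s) ->
  int a b f = int a b g.
Proof.
by move=> fg; apply: eq_Rintegral => s; rewrite inE/= in_itv/=; exact: fg.
Qed.

Lemma itgD a b f g : itv_integrable a b f -> itv_integrable a b g ->
  itv_integrable a b (fun s => f s + g s).
Proof. by move=> fi gi; exact: (integrableD (mu := mu) (measurable_itv `[a, b]) fi gi). Qed.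

Lemma itgB a b f g : itv_integrable a b f -> itv_integrable a b g ->
  itv_integrable a b (fun s => f s - g s).
Proof. by move=> fi gi; exact: (integrableB (mu := mu) (measurable_itv `[a, b]) fi gi). Qed.

Lemma itgZ a b c f : itv_integrable a b f -> itv_integrable a b (fun s => c * f s).
Proof. by move=> fi; exact: (integrableZl (mu := mu) (measurable_itv `[a, b]) c fi). Qed.

Lemma itg_norm a b f : itv_integrable a b f -> itv_integrable a b (fun s => `|f s|).
Proof. exact: integrable_norm. Qed.

Lemma itg_sum a b (I : Type) (r : seq I) (f : I -> R -> R) :
  (forall i, itv_integrable a b (f i)) -> itv_integrable a b (fun s => \sum_(i <- r) f i s).
Proof.
move=> fi; elim: r => [|i r ih].
  by apply: itg_eq (integrable0 mu _) => // s _; rewrite big_nil.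
by apply: itg_eq (itgD (fi i) ih) => // s _; rewrite big_cons.
Qed.

Lemma itg_cont a b f : {within `[a, b], continuous f} -> itv_integrable a b f.
Proof.
by move=> fc; apply: continuous_compact_integrable => //; exact: segment_compact.
Qed.

Lemma itg_cst a b c : itv_integrable a b (fun=> c).
Proof. by apply: itg_cont => s; exact: cst_continuous. Qed.

Lemma itg_sub a b a' b' f : a <= a' -> b' <= b ->
  itv_integrable a b f -> itv_integrable a' b' f.
Proof.
move=> aa bb; apply: integrableS => // s /=; rewrite !in_itv/= => /andP[p q].
by rewrite (le_trans aa)//= (le_trans q).
Qed.

Lemma itg_le a b f g : measurable_fun `[a, b] f ->
  (forall s, a <= s <= b -> `|f s| <= g s) -> itv_integrable a b g -> itv_integrable a b f.
Proof.
move=> mf fg; apply: le_integrable => //; first exact/measurable_EFinP.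
move=> s /=; rewrite in_itv/= => sab; rewrite lee_fin.
by rewrite (le_trans (fg _ sab))// ler_norm.
Qed.

Lemma itg_meas a b f : itv_integrable a b f -> measurable_fun `[a, b] f.
Proof. by move=> /integrableP[/measurable_EFinP]. Qed.

Lemma itv_cat a b c : a <= c -> c <= b ->
  `[a, b]%classic = `[a, c] `|` `[c, b].
Proof.
move=> ac cb; apply/seteqP; split => s /=; rewrite !in_itv/=.
  by move=> /andP[-> ->]; rewrite /= andbT; exact/orP/le_total.
by case=> /andP[p q]; rewrite ?p ?q ?(le_trans ac p) ?(le_trans q cb).
Qed.

Lemma itg_cat a b c f : a <= c -> c <= b ->
  itv_integrable a c f -> itv_integrable c b f -> itv_integrable a b f.
Proof.
move=> ac cb f1 f2; have mf : measurable_fun `[a, b] f.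
  rewrite (itv_cat ac cb); apply/measurable_funU => //; split.
  - exact: itg_meas f1.
  - exact: itg_meas f2.
apply/integrableP; split; first exact/measurable_EFinP.
(* The right piece drops [c], because additivity over a union asks for disjoint pieces. *)
have ab : `[a, b]%classic = `[a, c] `|` `]c, b].
  apply/seteqP; split => s /=; rewrite !in_itv/=.
    by move=> /andP[-> ->]; rewrite andbT; case: (leP s c); [left|right].
  case=> /andP[p q]; first by rewrite p (le_trans q).
  by rewrite q (le_trans ac (ltW p)).
have mn : measurable_fun `[a, b] (abse \o (EFin \o f)).
  by apply: measurableT_comp => //; exact/measurable_EFinP.
rewrite [X in (integral _ X _ < _)%E]ab ge0_integral_setU//=.
- apply: lte_add_pinfty.
    by case/integrableP : f1.
  have : mu.-integrable `]c, b] (EFin \o f).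
    apply: integrableS f2 => // s /=.
    by rewrite !in_itv/= => /andP[/ltW -> ->].
  by case/integrableP.
- by rewrite -ab.
- apply/disj_setPS => s [/=]; rewrite !in_itv/= => /andP[_ sc] /andP[].
  by rewrite ltNge sc.
Qed.

Lemma int_cat a b c f : a <= c -> c <= b -> itv_integrable a b f ->
  int a b f = int a c f + int c b f.
Proof.
move=> ac cb fi; have := @Rintegral_itvB _ f (BLeft a) (BRight b) c fi.
rewrite !bnd_simp => /(_ ac cb) h.
rewrite -(@Rintegral_itv_obnd_cbnd _ c (BRight b)).
  by rewrite -h addrC subrK.
by apply: integrableS fi => // s /=; rewrite !in_itv/= => /andP[p ->];
  rewrite (le_trans ac (ltW p)).
Qed.

Lemma intD a b f g : itv_integrable a b f -> itv_integrable a b g ->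
  int a b (fun s => f s + g s) = int a b f + int a b g.
Proof. by move=> fi gi; exact: RintegralD. Qed.

Lemma intB a b f g : itv_integrable a b f -> itv_integrable a b g ->
  int a b (fun s => f s - g s) = int a b f - int a b g.
Proof. by move=> fi gi; exact: RintegralB. Qed.

Lemma intZ a b c f : itv_integrable a b f -> int a b (fun s => c * f s) = c * int a b f.
Proof. by move=> fi; exact: RintegralZl. Qed.

Lemma int_cst a b c : a <= b -> int a b (fun=> c) = c * (b - a).
Proof.
move=> ab; rewrite Rintegral_cst//= lebesgue_measure_itv/= lte_fin.
by move: ab; rewrite le_eqVlt => /predU1P[->|->]; rewrite ?ltxx ?subrr.
Qed.

Lemma int_point a f : int a a f = 0.
Proof. by rewrite set_itv1 Rintegral_set1. Qed.

Lemma int_le a b f g : itv_integrable a b f -> itv_integrable a b g ->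
  (forall s, a <= s <= b -> f s <= g s) -> int a b f <= int a b g.
Proof.
by move=> fi gi fg; apply: le_Rintegral => // s /=; rewrite in_itv/=; exact: fg.
Qed.

Lemma int_ge0 a b f : (forall s, a <= s <= b -> 0 <= f s) -> 0 <= int a b f.
Proof. by move=> f0; apply: Rintegral_ge0 => s /=; rewrite in_itv/=; exact: f0. Qed.

Lemma int_norm_le a b f g : itv_integrable a b f -> itv_integrable a b g ->
  (forall s, a <= s <= b -> `|f s| <= g s) -> `|int a b f| <= int a b g.
Proof.
move=> fi gi fg; apply: le_trans (le_normr_Rintegral _ _) _ => //.
by apply: int_le => //; exact: itg_norm.
Qed.

(** Lebesgue measure is determined by its values on the intervals []a, b]], and the preimage of such
    an interval is a translate of the same length. *)
Lemma lebesgue_measure_shift c (A : set R) : measurable A ->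
  pushforward mu (fun s : measurableTypeR R => (s + c : measurableTypeR R)) A
    = mu A.
Proof.
move=> mA; have mc : measurable_fun setT
    (fun s : measurableTypeR R => (s + c : measurableTypeR R)).
  exact: measurable_funD.
apply/esym/lebesgue_measure_unique => //= _ [[a b]] _ <-.
rewrite /pushforward (_ : _ @^-1` _ = `]a - c, b - c]%classic); last first.
  by apply/seteqP; split=> s /=; rewrite !in_itv/= ltrBlDr lerBrDr.
rewrite !lebesgue_measure_itv/= !lte_fin ltrBlDr subrK.
by case: ifP => // _; congr EFin; ring.
Qed.

Lemma shift_preimage a b c :
  (fun s : R => s + c) @^-1` `[a + c, b + c] = `[a, b]%classic.
Proof. by apply/seteqP; split=> s /=; rewrite !in_itv/= !lerD2r. Qed.

Lemma measurable_shift a b c f : measurable_fun `[a + c, b + c] f ->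
  measurable_fun `[a, b] (fun s => f (s + c)).
Proof.
move=> mf; apply: (@measurable_comp _ _ _ _ _ _ `[a + c, b + c]) => //.
- by move=> _ [s + <-] /=; rewrite !in_itv/= !lerD2r.
- by apply: measurable_funTS; exact: measurable_funD.
Qed.

Lemma itg_shift a b c f : itv_integrable (a + c) (b + c) f ->
  itv_integrable a b (fun s => f (s + c)).
Proof.
move=> fi; have mf := itg_meas fi.
apply/integrableP; split; first by apply/measurable_EFinP; exact: measurable_shift.
pose phi : measurableTypeR R -> measurableTypeR R := fun s => s + c.
have mphi : measurable_fun setT phi by exact: measurable_funD.
rewrite -(shift_preimage a b c).
rewrite -(@ge0_integral_pushforward _ _ _ _ _ phi mphi mu `[a + c, b + c]%classic
  (abse \o (EFin \o f)))//.
- rewrite (@eq_measure_integral _ _ _ _ mu) => [|A mA _].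
    by case/integrableP: fi.
  exact: lebesgue_measure_shift.
- by apply: measurableT_comp => //; exact/measurable_EFinP.
- by move=> s _ /=; rewrite lee_fin.
Qed.

Lemma int_shift a b c f : itv_integrable (a + c) (b + c) f ->
  int a b (fun s => f (s + c)) = int (a + c) (b + c) f.
Proof.
move=> fi; have mf := itg_meas fi.
pose phi : measurableTypeR R -> measurableTypeR R := fun s => s + c.
have mphi : measurable_fun setT phi by exact: measurable_funD.
pose D : set (measurableTypeR R) := `[a + c, b + c]%classic.
have mD : measurable D by exact: measurable_itv.
(* The change of variables asks for an integrand measurable on the whole line, so [f] is extended by
   zero outside [D]. *)
pose F : measurableTypeR R -> \bar R := EFin \o (f \_ D).
have mF : measurable_fun setT F.
  have := (measurable_restrictT f mD).1 mf; rewrite /F => h; exact/measurable_EFinP.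
have FE s : D s -> F s = (f s)%:E by move=> Ds; rewrite /F/= patchE mem_set.
have iF : mu.-integrable (phi @^-1` D) (F \o phi).
  rewrite shift_preimage; apply: eq_integrable (itg_shift fi) => // s.
  rewrite inE/= in_itv/= => sab.
  by rewrite FE//= /phi/D/= in_itv/= !lerD2r.
have := integral_pushforward mphi mF iF mD.
rewrite [X in X = _ -> _](@eq_measure_integral _ _ _ _ mu); last first.
  by move=> A mA _; exact: lebesgue_measure_shift.
rewrite /Rintegral shift_preimage => h; congr fine; transitivity
  (\int[mu]_(x in `[a, b]) (F \o phi) x)%E; last first.
  by rewrite -h; apply: eq_integral => s; rewrite inE => /FE.
apply: eq_integral => s; rewrite inE/= in_itv/= => sab.
by rewrite FE//= /phi/D/= in_itv/= !lerD2r.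
Qed.

End interval_integrals.

(** * Gronwall's inequality in integral form *)

Section gronwall.
Variable R : realType.
Local Notation mu := (@lebesgue_measure R).
Local Notation int a b f := (Rintegral mu [set` `[a, b]] f).

Lemma is_derive_int (f : R -> R) (a b : R) : a < b ->
  {within `[a, b], continuous f} -> forall x, x \in `]a, b[ ->
  is_derive x 1 (fun s => int a s f) (f x).
Proof.
move=> ab fc x xab; have := xab; rewrite in_itv/= => /andP[ax xb].
have [d1 d2] := continuous_FTC1_closed xb (itg_cont fc) ax
  (within_continuous_continuous ab fc xab).
apply: DeriveDef; first exact: d1.
rewrite -derive1E; exact: d2.
Qed.

Lemma gronwall (f : R -> R) (a b S c : R) : a <= b -> 0 <= c ->
  {within `[a, b], continuous f} ->
  (forall s, a <= s <= b -> f s <= S + c * int a s f) ->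
  forall s, a <= s <= b -> f s <= S * expR (c * (s - a)).
Proof.
move=> ab c0 fc fS s sab.
have fi : itv_integrable a b f := itg_cont fc.
move: ab; rewrite le_eqVlt => /predU1P[ab|ab].
  subst b; have -> : s = a by apply/eqP; rewrite eq_le andbC.
  rewrite subrr mulr0 expR0 mulr1 (le_trans (fS a _)) ?lexx//.
  by rewrite int_point mulr0 addr0.
(* From here on the integral enters only as an abstract primitive [F] of [f] that vanishes at
   [a]. *)
have [F [dF cF Fa {}fS]] : exists F : R -> R,
    [/\ forall x, x \in `]a, b[ -> is_derive x 1 F (f x),
        {within `[a, b], continuous F}, F a = 0 &
        forall s, a <= s <= b -> f s <= S + c * F s].
  exists (fun s => int a s f); split.
  - exact: is_derive_int.
  - exact: (parameterized_integral_continuous (ltW ab) fi).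
  - exact: int_point.
  - exact: fS.
(* Integrating factor: the derivative of [H] is an exponential times [c * (f - (S + c * F))], hence
   nonpositive. *)
pose H := fun s => expR (- (c * (s - a))) * (S + c * F s).
have dH x : x \in `]a, b[ ->
    is_derive x 1 H (expR (- (c * (x - a))) * (c * f x - c * (S + c * F x))).
  move=> /dF ?; rewrite /H.
  apply: is_derive_eq; rewrite /GRing.scale/=; ring.
have cH : {within `[a, b], continuous H}.
  have ce : continuous (fun s : R => expR (- (c * (s - a)))).
    move=> x; apply: continuous_comp; last exact: continuous_expR.
    apply: cvgN; apply: cvgM; first exact: cvg_cst.
    by apply: cvgB; [exact: cvg_id|exact: cvg_cst].
  move=> x; apply: cvgM; first exact: (continuous_subspaceT ce).
  apply: cvgD; first exact: cvg_cst.
  apply: cvgM; first exact: cvg_cst.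
  exact: cF.
have Hle : H s <= H a.
  have/andP[as_ sb] := sab.
  have dH1 x : x \in `]a, b[ -> derivable H x 1 by move=> /dH[].
  have dH2 x : x \in `]a, b[ -> derive1 H x <= 0.
    move=> xab; rewrite derive1E (@derive_val _ _ _ _ _ _ _ (dH x xab)).
    rewrite mulr_ge0_le0 ?expR_ge0// -mulrBr mulr_ge0_le0// subr_le0.
    by apply: fS; move: xab; rewrite in_itv/= => /andP[/ltW -> /ltW ->].
  apply: (ler0_derive1_le_cc dH1 dH2 cH); last exact: as_.
  - by rewrite in_itv/= as_ sb.
  - by rewrite in_itv/= lexx ltW.
rewrite /H Fa mulr0 addr0 subrr mulr0 oppr0 expR0 mul1r in Hle.
rewrite (le_trans (fS s sab))//.
rewrite -(@ler_pM2l _ (expR (- (c * (s - a))))) ?expR_gt0//.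
by rewrite (le_trans Hle)// mulrCA -expRD addNr expR0 mulr1.
Qed.

End gronwall.

Section coordinatewise_limits.
Variables (R : realType) (T : Type) (F : set_system T) (FF : Filter F).

Lemma cvgr_sum (I : Type) (r : seq I) (f : I -> T -> R) (l : I -> R) :
  (forall i, f i @ F --> l i) ->
  (fun t => \sum_(i <- r) f i t) @ F --> \sum_(i <- r) l i.
Proof.
move=> fl; elim: r => [|i r ih].
  by under eq_fun do rewrite big_nil; rewrite big_nil; exact: cvg_cst.
by under eq_fun do rewrite big_cons; rewrite big_cons; exact: cvgD.
Qed.

Lemma cvg_coord (n : nat) (X : T -> 'cV[R]_n) (x : 'cV[R]_n) :
  (forall i, (fun t => X t i 0) @ F --> x i 0) -> X @ F --> x.
Proof.
move=> Xx; apply/cvgrPdist_le => e e0.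
have h : \forall t \near F, forall i, `|x i 0 - X t i 0| <= e.
  by apply: filter_forall => i; have /cvgrPdist_le := Xx i; exact.
apply: filterS h => t h; apply: normv_le; first exact: ltW.
by move=> i; have := h i; rewrite !mxE.
Qed.

End coordinatewise_limits.

(** * The homogeneous equation, solved by the series of the matrix exponential *)

Section linear_ode.
Variables (R : realType) (d : nat) (A : 'M[R]_d).
Local Notation mu := (@lebesgue_measure R).
Local Notation int a b f := (Rintegral mu [set` `[a, b]] f).

(** Taylor coefficients of the [i]-th coordinate of [exp(sA) y]. Working coordinate by coordinate
    makes termwise differentiation of scalar power series applicable. *)
Let coef (y : 'cV[R]_d) (i : 'I_d) (n : nat) : R :=
  (iter n (mulmx A) y) i 0 / n`!%:R.

(** Differentiating [exp(sA) y] termwise amounts to replacing the initial vector [y] by [A y]. *)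
Let coef_diffs y i : pseries_diffs (coef y i) = coef (A *m y) i.
Proof.
apply/funext => n; rewrite /pseries_diffs /coef factS natrM invfM.
by rewrite iterSr mulrCA mulVKf ?pnatr_eq0.
Qed.

(** Since [|A^n y| <= a^n |y|], the series is dominated by that of [|y| exp(a |x|)]. *)
Let coef_cvg y i (x : R) : cvgn (pseries (coef y i) x).
Proof.
have [a a0 Aa] := mulmx_bounded A.
apply: normed_cvg; apply: (@series_le_cvg _ _ (fun n => `|y| * exp_coeff (a * `|x|) n)).
- by move=> n /=.
- by move=> n; rewrite mulr_ge0// /exp_coeff/= divr_ge0// exprn_ge0// mulr_ge0.
- move=> n; rewrite /coef /exp_coeff/= !normrM normfV normrX (ger0_norm (ler0n _ _)).
  rewrite exprMn mulrAC mulrA ler_wpM2r ?invr_ge0 ?ler0n// mulrA.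
  rewrite ler_wpM2r ?exprn_ge0// (le_trans (normv_coord _ _))//.
  elim: n => [|n ih]; first by rewrite expr0 mulr1.
  by rewrite iterS (le_trans (Aa _))// exprS mulrCA ler_wpM2l.
- exact: (@is_cvg_seriesZ _ _ `|y| (is_cvg_series_exp_coeff _)).
Qed.

Let sol y i (s : R) : R := limn (pseries (coef y i) s).

Let sol0 y i : sol y i 0 = y i 0.
Proof.
apply: lim_near_cst => //; near=> n.
rewrite /pseries/= /series/= -(@prednK n); last by near: n; exists 1%N.
rewrite big_nat_recl// big1 => [|m _]; last by rewrite expr0n mulr0.
by rewrite expr0 mulr1 addr0 /coef/= invr1 mulr1.
Unshelve. all: by end_near. Qed.

(** [A] commutes with its powers, so it can be moved from the initial vector to the outside of the
    series. Together with [coef_diffs] this is the differential equation. *)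
Let sol_mul y i s : sol (A *m y) i s = \sum_j A i j * sol y j s.
Proof.
apply/cvg_lim => //; rewrite [X in X @ _ --> _](_ : _ =
    (fun n => \sum_j A i j * pseries (coef y j) s n)); last first.
  apply/funext => n; rewrite /pseries/series/=.
  under [RHS]eq_bigr do rewrite mulr_sumr.
  rewrite exchange_big; apply: eq_bigr => m _ /=.
  rewrite /coef -iterSr iterS mxE !mulr_suml.
  by apply: eq_bigr => j _; rewrite !mulrA.
by apply: cvgr_sum => j; apply: cvgMr; exact: coef_cvg.
Qed.

Let is_derive_sol y i (s : R) : is_derive s 1 (sol y i) (sol (A *m y) i s).
Proof.
rewrite /sol -coef_diffs; apply: (@pseries_snd_diffs _ _ (`|s| + 1)).
- exact: coef_cvg.
- by rewrite coef_diffs; exact: coef_cvg.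
- by rewrite !coef_diffs; exact: coef_cvg.
- by rewrite [ltRHS]ger0_norm ?addr_ge0// ltrDl.
Qed.

Lemma linear_ode_exists (y : 'cV[R]_d) (a : R) :
  exists p : R -> 'cV[R]_d, p a = y /\
    forall i (s : R), is_derive s (1 : R) (fun r => p r i 0) ((A *m p s) i 0).
Proof.
exists (fun s => \col_i sol y i (s - a)); split.
  by apply/colP => i; rewrite mxE subrr sol0.
move=> i s; rewrite mxE.
rewrite (eq_bigr (fun j => A i j * sol y j (s - a))) => [|j _]; last by rewrite mxE.
rewrite -sol_mul (_ : (fun r => _) = sol y i \o (fun r => r - a)); last first.
  by apply/funext => r; rewrite mxE.
have h := is_derive_sol y i (s - a).
rewrite -[X in is_derive _ _ _ X]mulr1.
have h1 : is_derive s (1 : R) (fun r : R => r - a) 1.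
  by apply: is_derive_eq; rewrite subr0.
exact: (@is_derive1_comp _ (sol y i) (fun r => r - a) s _ _ h h1).
Qed.

End linear_ode.

(** * Linear control systems *)

Section controls.
Variables (R : realType) (k : nat).
Local Notation mu := (@lebesgue_measure R).
Local Notation int a b f := (Rintegral mu [set` `[a, b]] f).
Implicit Types (a b c : R) (u : R -> 'cV[R]_k).

Definition L2_control a b u :=
  (forall j, measurable_fun `[a, b] (fun s => u s j 0)) /\
  itv_integrable a b (fun s => enorm (u s) ^+ 2).

Lemma measurable_sqr_enorm a b u :
  (forall j, measurable_fun `[a, b] (fun s => u s j 0)) ->
  measurable_fun `[a, b] (fun s => enorm (u s) ^+ 2).
Proof.
move=> mu_; rewrite (_ : (fun s => _) = (fun s => \sum_j u s j 0 ^+ 2)).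
  by apply: measurable_sum => j; apply: measurable_funX.
by apply/funext => s; exact: sqr_enorm.
Qed.

Lemma is_controlP a b u : is_control 2 a b u <-> L2_control a b u.
Proof.
split=> -[mu_ iu]; split=> //.
  apply/integrableP; split; first by apply/measurable_EFinP; exact: measurable_sqr_enorm.
  apply: le_lt_trans iu; rewrite le_eqVlt; apply/orP; left; apply/eqP.
  by apply: eq_integral => s _ /=; rewrite ger0_norm ?sqr_ge0.
case/integrableP: iu => _; apply: le_lt_trans.
rewrite le_eqVlt; apply/orP; left; apply/eqP.
by apply: eq_integral => s _ /=; rewrite ger0_norm ?sqr_ge0.
Qed.

Lemma ctl_sub a b a' b' u : a <= a' -> b' <= b -> L2_control a b u -> L2_control a' b' u.
Proof.
move=> aa bb [mu_ iu]; split; last exact: itg_sub iu.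
move=> j; apply: measurable_funS (mu_ j) => // s /=.
by rewrite !in_itv/= => /andP[p q]; rewrite (le_trans aa)//= (le_trans q).
Qed.

Lemma ctl0 a b : L2_control a b (fun=> 0).
Proof.
split=> [j|]; first by apply: measurable_cst.
apply: itg_eq (itg_cst a b 0) => s _.
by rewrite sqr_enorm big1// => i _; rewrite mxE expr0n.
Qed.

(** On a bounded interval the pointwise bound [|u| <= 1 + |u| ^ 2] replaces the Cauchy-Schwarz
    inequality. *)
Lemma ctl_enorm a b u : L2_control a b u -> itv_integrable a b (fun s => enorm (u s)).
Proof.
move=> [mu_ iu]; apply: (@itg_le _ _ _ _ (fun s => 1 + enorm (u s) ^+ 2)).
- rewrite (_ : (fun s => _) = Num.sqrt \o (fun s => enorm (u s) ^+ 2)).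
    apply: measurableT_comp; last exact: measurable_sqr_enorm.
    by apply: continuous_measurable_fun; exact: sqrt_continuous.
  by apply/funext => s /=; rewrite sqrtr_sqr ger0_norm ?enorm_ge0.
- by move=> s _; rewrite ger0_norm ?enorm_ge0//; nra.
- by apply: itgD => //; exact: itg_cst.
Qed.

Lemma ctl_coord a b u j : L2_control a b u -> itv_integrable a b (fun s => u s j 0).
Proof.
move=> cu; apply: itg_le (ctl_enorm cu); first exact: cu.1.
by move=> s _; rewrite (le_trans (normv_coord _ _)) ?normv_le_enorm.
Qed.

Lemma ctl_shift a b c u : L2_control (a + c) (b + c) u -> L2_control a b (fun s => u (s + c)).
Proof.
move=> [mu_ iu]; split=> [j|]; last exact: (itg_shift iu).
exact: (measurable_shift (mu_ j)).
Qed.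

End controls.

(** * Concatenation of controls *)

Section gluing.
Variable R : realType.
Local Notation mu := (@lebesgue_measure R).
Local Notation int a b f := (Rintegral mu [set` `[a, b]] f).
Implicit Types (a b c : R).

(** The left endpoint is exempted because a function spliced at [a] takes there the value of its
    left piece, whatever the right piece is. *)
Lemma measurable_eq_oc a b (f g : R -> R) : (forall s, a < s <= b -> f s = g s) ->
  measurable_fun `[a, b] f -> measurable_fun `[a, b] g.
Proof.
move=> fg mf; have [ab|ab] := leP a b; last first.
  by rewrite set_itv_ge ?bnd_simp -?ltNge//; exact: measurable_fun_set0.
rewrite -(setU1itv (a := BRight b) (x := a) false) ?bnd_simp//.
apply/measurable_funU => //; split; first exact: measurable_fun_set1.
apply: (@eq_measurable_fun _ _ _ _ _ f).
  by move=> s; rewrite inE/= in_itv/=; exact: fg.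
apply: measurable_funS mf => // s /=.
by rewrite !in_itv/= => /andP[/ltW -> ->].
Qed.

Lemma itg_eq_oc a b (f g : R -> R) : (forall s, a < s <= b -> f s = g s) ->
  itv_integrable a b f -> itv_integrable a b g.
Proof.
move=> fg fi; have mg := measurable_eq_oc fg (itg_meas fi).
apply/integrableP; split; first exact/measurable_EFinP.
case/integrableP : fi => mf; apply: le_lt_trans.
have mn (h : R -> R) : measurable_fun `[a, b] h ->
    measurable_fun `]a, b] (abse \o (EFin \o h)).
  move=> mh; apply: measurableT_comp => //; apply/measurable_EFinP.
  apply: measurable_funS mh => // s /=.
  by rewrite !in_itv/= => /andP[/ltW -> ->].
rewrite -(@integral_itv_obnd_cbnd _ a (BRight b) (abse \o (EFin \o g))); last exact: mn.
rewrite -(@integral_itv_obnd_cbnd _ a (BRight b) (abse \o (EFin \o f)));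
  last by apply: mn; exact/measurable_EFinP.
rewrite le_eqVlt; apply/orP; left; apply/eqP.
by apply: eq_integral => s; rewrite inE/= in_itv/= => /fg ->.
Qed.

Lemma int_eq_oc a b (f g : R -> R) : (forall s, a < s <= b -> f s = g s) ->
  itv_integrable a b f -> int a b f = int a b g.
Proof.
move=> fg fi; have gi := itg_eq_oc fg fi.
have sub (h : R -> R) : itv_integrable a b h -> mu.-integrable `]a, b] (EFin \o h).
  by apply: integrableS => // s /=; rewrite !in_itv/= => /andP[/ltW -> ->].
rewrite -(@Rintegral_itv_obnd_cbnd _ a (BRight b) f (sub _ fi)).
rewrite -(@Rintegral_itv_obnd_cbnd _ a (BRight b) g (sub _ gi)).
by apply: eq_Rintegral => s; rewrite inE/= in_itv/=; exact: fg.
Qed.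

Definition splice (T : Type) (c : R) (f g : R -> T) (s : R) : T :=
  if s <= c then f s else g s.

Lemma splice_l (T : Type) c (f g : R -> T) s : s <= c -> splice c f g s = f s.
Proof. by rewrite /splice => ->. Qed.

Lemma splice_r (T : Type) c (f g : R -> T) s : c < s -> splice c f g s = g s.
Proof. by rewrite /splice leNgt => ->. Qed.

Lemma ctl_splice (k : nat) a b c (u v : R -> 'cV[R]_k) : a <= c -> c <= b ->
  L2_control a c u -> L2_control c b v -> L2_control a b (splice c u v).
Proof.
move=> ac cb [mu_ iu] [mv iv]; split.
  move=> j; rewrite (itv_cat ac cb); apply/measurable_funU => //; split.
    apply: eq_measurable_fun (mu_ j) => s; rewrite inE/= in_itv/= => /andP[_ sc].
    by rewrite splice_l.
  by apply: measurable_eq_oc (mv j) => s /andP[cs _]; rewrite splice_r.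
apply: (itg_cat ac cb).
  by apply: itg_eq iu => s /andP[_ sc]; rewrite splice_l.
by apply: itg_eq_oc iv => s /andP[cs _]; rewrite splice_r.
Qed.

End gluing.

(** * Trajectories: restriction, superposition, concatenation, translation *)

Section trajectories.
Variables (R : realType) (d k : nat) (A : 'M[R]_d) (B : 'M[R]_(d, k)).
Local Notation mu := (@lebesgue_measure R).
Local Notation int a b f := (Rintegral mu [set` `[a, b]] f).
Implicit Types (a b c : R) (u v : R -> 'cV[R]_k) (g p : R -> 'cV[R]_d).

Definition velocity g u (i : 'I_d) (s : R) : R := (A *m g s + B *m u s) i 0.

(** The initial value is read off [g], so that restrictions, translates and concatenations of
    solutions are again of this form without a separate datum. *)
Definition solution a b u g :=
  {within `[a, b], continuous g} /\
  forall s, a <= s <= b -> forall i,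
    g s i 0 = g a i 0 + int a s (velocity g u i).

Lemma is_trajectoryP a b x u g : a <= b ->
  is_trajectory A B a b x u g <-> solution a b u g /\ g a = x.
Proof.
move=> ab; split=> [[gc gE]|[[gc gE] gx]].
  have gx : g a = x.
    rewrite gE ?in_itv/= ?lexx//; apply/colP => i.
    by rewrite !mxE int_point addr0.
  split=> //; split=> // s sab i.
  by rewrite [in LHS]gE ?in_itv//= gx !mxE.
split=> // s; rewrite in_itv/= => sab; apply/colP => i.
by rewrite gE// gx !mxE.
Qed.

Lemma coord_within a b g i : {within `[a, b], continuous g} ->
  {within `[a, b], continuous (fun s => g s i 0)}.
Proof.
move=> gc s; exact: (@continuous_comp (subspace `[a, b]) 'cV[R]_d R g (fun M => M i 0)
  s (gc s) (@coord_continuous R d 1 i 0 (g s))).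
Qed.

Lemma within_coord a b g :
  (forall i, {within `[a, b], continuous (fun s => g s i 0)}) ->
  {within `[a, b], continuous g}.
Proof.
by move=> gc s; apply: cvg_coord => i; exact: gc.
Qed.

Lemma velocity_itg a b u g i : {within `[a, b], continuous g} -> L2_control a b u ->
  itv_integrable a b (velocity g u i).
Proof.
move=> gc cu; apply: (@itg_eq _ _ _ (fun s =>
  \sum_j A i j * g s j 0 + \sum_j B i j * u s j 0)).
  by move=> s _; rewrite /velocity !mxE.
apply: itgD; apply: itg_sum => j; apply: itgZ; last exact: ctl_coord cu.
by apply: itg_cont; exact: coord_within.
Qed.

Lemma traj_cont a b u g : solution a b u g -> {within `[a, b], continuous g}.
Proof. by case. Qed.

Lemma within_sub (V : topologicalType) a b a' b' (f : R -> V) :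
  a <= a' -> b' <= b -> {within `[a, b], continuous f} ->
  {within `[a', b'], continuous f}.
Proof.
move=> aa bb; apply: continuous_subspaceW => s /=.
by rewrite !in_itv/= => /andP[p q]; rewrite (le_trans aa)//= (le_trans q).
Qed.

Lemma traj_incr a b s t u g i : L2_control a b u -> solution a b u g ->
  a <= s -> s <= t -> t <= b ->
  g t i 0 = g s i 0 + int s t (velocity g u i).
Proof.
move=> cu [gc gE] as_ st tb.
rewrite gE ?(le_trans as_ st)// [in RHS]gE ?as_ ?(le_trans st)//.
rewrite (int_cat as_ st) ?addrA//.
by apply: itg_sub (velocity_itg i gc cu).
Qed.

Lemma traj_sub a b a' b' u g : a <= a' -> b' <= b -> L2_control a b u ->
  solution a b u g -> solution a' b' u g.
Proof.
move=> aa bb cu tg; split; first exact: within_sub (tg.1).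
move=> s /andP[as_ sb] i.
by rewrite (traj_incr i cu tg (t := s) (s := a'))// (le_trans sb).
Qed.

(** Superposition. Every change of the initial point, or of the value at a junction, is made by
    adding a multiple of a homogeneous solution, so the control and its energy stay the same. *)
Lemma traj_add a b u g p c : L2_control a b u -> solution a b u g -> solution a b (fun=> 0) p ->
  solution a b u (fun s => g s + c *: p s).
Proof.
move=> cu [gc gE] [pc pE]; split.
  by move=> s; apply: cvgD; [exact: gc|apply: cvgZr; exact: pc].
move=> s sab i; have /andP[as_ sb] := sab.
have vg : itv_integrable a s (velocity g u i).
  by apply: itg_sub (velocity_itg i gc cu).
have vp : itv_integrable a s (velocity p (fun=> 0) i).
  by apply: itg_sub (velocity_itg i pc (ctl0 _ _ _)).
rewrite !mxE gE// pE//.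
have -> : int a s (velocity (fun r => g r + c *: p r) u i) =
    int a s (fun r => velocity g u i r + c * velocity p (fun=> 0) i r).
  apply: int_eq => r _; rewrite /velocity mulmx0 addr0 mulmxDr -scalemxAr !mxE.
  ring.
rewrite intD//; last exact: itgZ.
by rewrite intZ//; ring.
Qed.

Lemma traj_splice a b c u v g p : a <= c -> c <= b -> L2_control a c u -> L2_control c b v ->
  solution a c u g -> solution c b v p -> g c = p c ->
  solution a b (splice c u v) (splice c g p).
Proof.
move=> ac cb cu cv [gc gE] [pc pE] gp.
have E1 s : s <= c -> splice c g p s = g s by exact: splice_l.
have E2 s : c <= s -> splice c g p s = p s.
  by rewrite le_eqVlt => /predU1P[<-|cs]; [rewrite splice_l|rewrite splice_r].
have cont : {within `[a, b], continuous (splice c g p)}.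
  rewrite (itv_cat ac cb); apply: withinU_continuous.
  - exact: itv_closed.
  - exact: itv_closed.
  - apply: (@subspace_eq_continuous _ _ _ g) gc => s.
    by rewrite inE/= in_itv/= => /andP[_ /E1].
  - apply: (@subspace_eq_continuous _ _ _ p) pc => s.
    by rewrite inE/= in_itv/= => /andP[/E2].
have vi i := velocity_itg i cont (ctl_splice ac cb cu cv).
have left s i : a <= s -> s <= c -> int a s (velocity (splice c g p) (splice c u v) i) =
    int a s (velocity g u i).
  move=> as_ sc; apply: int_eq => r /andP[ar rs].
  by rewrite /velocity !splice_l ?(le_trans rs).
split=> // s /andP[as_ sb] i; rewrite [splice c g p a]E1//.
have [sc|cs] := leP s c.
  by rewrite E1// left// gE// as_.
rewrite E2 ?ltW// pE ?sb ?ltW// (int_cat ac (ltW cs)); last first.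
  by apply: itg_sub (vi i).
rewrite left// -gp gE ?ac ?lexx// addrA; congr (_ + _).
apply: int_eq_oc.
  by move=> r /andP[cr rs]; rewrite /velocity !splice_r.
by apply: itg_sub (velocity_itg i pc cv).
Qed.

(** The system is autonomous, so a translation in time preserves the equation. *)
Lemma traj_shift a b c u g : L2_control (a + c) (b + c) u -> solution (a + c) (b + c) u g ->
  solution a b (fun s => u (s + c)) (fun s => g (s + c)).
Proof.
move=> cu [gc gE]; split.
  apply/subspace_continuousP => s; rewrite /= in_itv/= => sab.
  have sc : `[a + c, b + c]%classic (s + c) by rewrite /= in_itv/= !lerD2r.
  have /subspace_continuousP gc' := gc; have gs := gc' (s + c) sc.
  apply: (@cvg_comp _ _ _ (fun r => r + c) g _ _ _ _ gs) => P.
  have shiftc : (r + c) @[r --> s] --> s + c.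
    by apply: cvgD; [exact: cvg_id|exact: cvg_cst].
  move=> /shiftc h; apply: (@filterS _ (nbhs s) (nbhs_filter s) _ _ _ h) => r /= {}h.
  by rewrite in_itv/= => rab; apply: h; rewrite in_itv/= !lerD2r.
move=> s /andP[as_ sb] i; rewrite gE ?lerD2r ?as_//; congr (_ + _).
rewrite -(@int_shift _ _ _ _ (velocity g u i)) //.
by apply: itg_sub (velocity_itg i gc cu); rewrite ?lerD2r.
Qed.

(** The power series converges on the whole line, so one [p] serves every end time [b]; the integral
    form follows from the fundamental theorem of calculus in each coordinate. *)
Lemma homogeneous_exists (y : 'cV[R]_d) a :
  exists p, p a = y /\ forall b, solution a b (fun=> 0) p.
Proof.
have [p [pa pd]] := linear_ode_exists A y a.
exists p; split=> // b.
have cp i : continuous (fun s => p s i 0).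
  move=> s; have [/derivable1_diffP/differentiable_continuous] := pd i s.
  exact.
have cv i : continuous (fun s => (A *m p s) i 0).
  under eq_fun do rewrite mxE.
  by move=> s; apply: cvgr_sum => j; apply: cvgMr; exact: cp.
split; first by apply: within_coord => i; exact: continuous_subspaceT.
move=> s /andP[]; rewrite le_eqVlt => /predU1P[->|as_] sb i.
  by rewrite int_point addr0.
have h : (\int[mu]_(x in `[a, s]) ((A *m p x) i 0)%:E =
    (p s i 0)%:E - (p a i 0)%:E)%E.
  apply: (@continuous_FTC2 _ (fun x => (A *m p x) i 0) (fun x => p x i 0) _ _ as_).
  - exact: continuous_subspaceT.
  - split.
    + by move=> x _; case: (pd i x).
    + exact/cvg_at_right_filter/cp.
    + exact/cvg_at_left_filter/cp.
  - by move=> x _; rewrite derive1E; exact: derive_val.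
rewrite (@int_eq _ _ _ _ (fun r => (A *m p r) i 0)).
  by rewrite /Rintegral h/= addrCA subrr addr0.
by move=> r _; rewrite /velocity mulmx0 addr0.
Qed.

End trajectories.

(** * A priori bounds for trajectories *)

Section trajectory_bounds.
Variables (R : realType) (d k : nat) (A : 'M[R]_d) (B : 'M[R]_(d, k)).
Local Notation mu := (@lebesgue_measure R).
Local Notation int a b f := (Rintegral mu [set` `[a, b]] f).

Lemma traj_increment_le (a b s : R) u g (w : R -> R) : L2_control a b u ->
  solution A B a b u g -> a <= s <= b -> itv_integrable a s w ->
  (forall r, a <= r <= s -> `|A *m g r| + `|B *m u r| <= w r) ->
  `|g s - g a| <= int a s w.
Proof.
move=> cu tg /andP[as_ sb] iw hw; apply: normv_le.
  by apply: int_ge0 => r /hw; apply: le_trans; rewrite addr_ge0.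
move=> i; rewrite !mxE (traj_incr i cu tg (lexx a) as_ sb) addrAC subrr add0r.
apply: int_norm_le => //.
  by apply: itg_sub (velocity_itg A B i (traj_cont tg) cu).
move=> r /hw; apply: le_trans; rewrite /velocity mxE.
by rewrite (le_trans (ler_normD _ _))// lerD// normv_coord.
Qed.

(** [K] depends on the length bound [tau] only, and the control enters through its integral up to
    [s]. Applied to a difference that starts at [0], this bounds the effect of the control alone. *)
Lemma traj_bounds (tau : R) : 0 <= tau -> exists2 K : R, 0 <= K &
  forall (a b : R) u g, a <= b -> b - a <= tau -> L2_control a b u -> solution A B a b u g ->
  forall s, a <= s <= b ->
  `|g s| <= K * (`|g a| + int a s (fun r => enorm (u r))).
Proof.
move=> tau0; have [al al0 hA] := mulmx_bounded A.
have [be be0 hB] := mulmx_bounded B.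
exists ((1 + be) * expR (al * tau)); first by rewrite mulr_ge0 ?addr_ge0 ?expR_ge0.
move=> a b u g ab btau cu tg s0 /andP[as0 s0b].
(* [U] stops at [s0]: it is then a constant on [[a, s0]], as [gronwall] requires, and the conclusion
   is read at the endpoint [s0]. *)
set U := int a s0 (fun r => enorm (u r)).
have U0 : 0 <= U by apply: int_ge0 => r _; exact: enorm_ge0.
have gn : {within `[a, s0], continuous (fun s => `|g s|)}.
  by move=> s; apply: cvg_norm; exact: (within_sub (lexx a) s0b (traj_cont tg)).
have iu : itv_integrable a s0 (fun r => enorm (u r)).
  by apply: itg_sub (ctl_enorm cu).
have := @gronwall _ (fun s => `|g s|) a s0 (`|g a| + be * U) al as0 al0 gn.
move=> /(_ _ s0) h; apply: le_trans (h _ _) _; last 2 first.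
- by rewrite as0 lexx.
- apply: (@le_trans _ _ ((`|g a| + be * U) * expR (al * tau))).
    rewrite ler_wpM2l ?addr_ge0 ?mulr_ge0// ler_expR ler_wpM2l//.
    by rewrite (le_trans _ btau)// lerD2r.
  rewrite [leRHS]mulrAC ler_wpM2r ?expR_ge0//.
  have := normr_ge0 (g a); nra.
move=> s /andP[as_ ss0].
have gi : itv_integrable a s (fun r => `|g r|) by apply: itg_sub (itg_cont gn).
have ui : itv_integrable a s (fun r => enorm (u r)) by apply: itg_sub iu.
have le1 : `|g s - g a| <= int a s (fun r => al * `|g r| + be * enorm (u r)).
  apply: (traj_increment_le cu tg); first by rewrite as_ (le_trans ss0).
    by apply: itgD; exact: itgZ.
  move=> r _; rewrite lerD// (le_trans (hB _))// ler_wpM2l//.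
  exact: normv_le_enorm.
rewrite intD ?intZ// in le1; try exact: itgZ.
have leU : int a s (fun r => enorm (u r)) <= U.
  rewrite /U (int_cat as_ ss0)// lerDl; apply: int_ge0 => r _; exact: enorm_ge0.
rewrite -[g s](subrK (g a)) (le_trans (ler_normD _ _))// addrC -addrA lerD2l.
by apply: (le_trans le1); rewrite [leLHS]addrC lerD2r ler_wpM2l.
Qed.

(** The second bound integrates [|A p| <= al * K * |p a|] over [[a, s]]. Because of it, a correction
    of first order changes only by a second-order amount during a time [delta]. *)
Lemma homogeneous_bounds (tau : R) : 0 <= tau -> exists2 K : R, 0 <= K &
  forall (a b : R) p, a <= b -> b - a <= tau -> solution A B a b (fun=> 0) p ->
  forall s, a <= s <= b -> `|p s| <= K * `|p a| /\
    `|p s - p a| <= K * (s - a) * `|p a|.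
Proof.
move=> tau0; have [al al0 hA] := mulmx_bounded A.
have [K K0 hK] := traj_bounds tau0.
exists (K + al * K); first by rewrite addr_ge0// mulr_ge0.
move=> a b p ab btau tp.
have E0 (s : R) : int a s (fun=> enorm (0 : 'cV[R]_k)) = 0.
  have -> : enorm (0 : 'cV[R]_k) = 0.
    by rewrite /enorm big1 ?sqrtr0// => i _; rewrite mxE expr0n.
  by rewrite /Rintegral integral0.
have pK s : a <= s <= b -> `|p s| <= K * `|p a|.
  by move=> sab; have := hK _ _ _ _ ab btau (ctl0 _ _ _) tp s sab; rewrite E0 addr0.
move=> s sab; split.
  by rewrite (le_trans (pK s sab))// ler_wpM2r// lerDl mulr_ge0.
have /andP[as_ sb] := sab.
apply: (@le_trans _ _ (int a s (fun=> al * (K * `|p a|)))).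
  apply: (traj_increment_le (ctl0 _ _ _) tp sab); first exact: itg_cst.
  move=> r /andP[ar rs]; rewrite mulmx0 normr0 addr0 (le_trans (hA _))//.
  by rewrite ler_wpM2l// pK// ar (le_trans rs).
rewrite int_cst//; have := normr_ge0 (p a).
have : 0 <= K * (s - a) by rewrite mulr_ge0// subr_ge0.
move=> ? ?; rewrite mulrDl mulrDl mulrA mulrAC lerDr mulr_ge0//.
Qed.

End trajectory_bounds.

(** * Continuous functions of measurable coordinates *)

Section continuous_composition.
Variable R : realType.

(** The boxes with rational centre and radius [1 / (n + 1)] are countably many and exhaust every
    open set from inside. *)
Lemma rational_box (N : nat) (O : set 'cV[R]_N) (w : 'cV[R]_N) : open O -> O w ->
  exists (q : 'cV[rat]_N) (n : nat),
    (forall i, `|w i 0 - ratr (q i 0)| < n.+1%:R^-1) /\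
    forall v : 'cV[R]_N,
      (forall i, `|v i 0 - ratr (q i 0)| < n.+1%:R^-1) -> O v.
Proof.
rewrite openE => oO /oO /nbhs_ballP[e /= e0 eO].
have [n ne] : exists n, n.+1%:R^-1 < e / 2.
  have e20 : 0 < e / 2 by rewrite divr_gt0.
  have [n _ hn] := near_infty_natSinv_lt (PosNum e20).
  by exists n; exact: (hn n (leqnn n)).
have dens (r : R) : exists q : rat, `|r - ratr q| < n.+1%:R^-1.
  have : r - n.+1%:R^-1 < r + n.+1%:R^-1.
    by rewrite ltrD2l gtrN// invr_gt0.
  move=> /rat_in_itvoo[q]; rewrite in_itv/= => /andP[q1 q2]; exists q.
  by rewrite ltr_distl ltrBlDr q2 -ltrBlDr q1.
(* The default [0] of [xget] is never taken, by [dens]. *)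
pose q := \col_i xget 0 [set q : rat | `|w i 0 - ratr q| < n.+1%:R^-1].
have qE i : `|w i 0 - ratr (q i 0)| < n.+1%:R^-1.
  rewrite mxE; case: xgetP => [y -> //|]; have [x hx] := dens (w i 0).
  by move=> /(_ x)/(_ hx).
exists q, n; split=> // v vq; apply: eO.
rewrite -ball_normE /ball_/=.
apply: (@le_lt_trans _ _ (n.+1%:R^-1 + n.+1%:R^-1)); last by rewrite [ltRHS](splitr e) ltrD.
apply: normv_le => [|i]; first by rewrite addr_ge0// invr_ge0.
rewrite !mxE -(subrKA (ratr (q i 0))) (le_trans (ler_normD _ _))//.
by apply: lerD; apply: ltW; [exact: qE|rewrite distrC; exact: vq].
Qed.

(** The preimage of an interval under [f] is open, hence a countable union of boxes, and the
    preimage of a box under [w] is a finite intersection of sets measurable by the hypothesis on the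
    coordinates. *)
Lemma measurable_continuous_comp (N : nat) (D : set R) (f : 'cV[R]_N -> R)
    (w : R -> 'cV[R]_N) : measurable D -> continuous f ->
  (forall i, measurable_fun D (fun s => w s i 0)) ->
  measurable_fun D (fun s => f (w s)).
Proof.
move=> mD cf mw; apply: (measurability _ (RGenOpens.measurableE R)).
move=> _ [_ [a [b ->] <-]]; set O := f @^-1` `]a, b[.
have oO : open O by apply: open_comp => [x _|]; [exact: cf|exact: interval_open].
pose box (i : 'cV[rat]_N * nat) : set 'cV[R]_N :=
  [set v | forall j, `|v j 0 - ratr (i.1 j 0)| < i.2.+1%:R^-1].
have mbox i : measurable (D `&` w @^-1` box i).
  have -> : D `&` w @^-1` box i = D `&` \bigcap_(j in [set: 'I_N])
      (D `&` (fun s => w s j 0) @^-1` `]ratr (i.1 j 0) - i.2.+1%:R^-1,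
                                       ratr (i.1 j 0) + i.2.+1%:R^-1[).
    apply/seteqP; split=> s /= [Ds h]; split=> // j.
      by move=> _; split=> //=; rewrite in_itv/= -ltr_distl; exact: h.
    by have [_] := h j I; rewrite /= in_itv/= -ltr_distl.
  apply: measurableI => //; apply: fin_bigcap_measurable => //.
  by move=> j _; apply: mw => //; exact: measurable_itv.
(* The union runs over codes of pairs of centre and radius index; codes of nothing and boxes that
   leave [O] contribute the empty set. *)
rewrite (_ : _ `&` _ = \bigcup_n (if unpickle n is Some i then
    if asbool (box i `<=` O) then D `&` w @^-1` box i else set0 else set0)).
  apply: bigcup_measurable => n _; case: unpickle => // i.
  by case: asboolP.
apply/seteqP; split=> s /=.
  move=> [Ds Os]; have [q [n [h1 h2]]] := rational_box oO Os.
  exists (pickle (q, n)) => //=; rewrite pickleK.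
  by case: asboolP => // -[]; exact: h2.
by move=> [n _]; case: unpickle => // i; case: asboolP => // bO [Ds /bO].
Qed.

End continuous_composition.

(** * Control problems with semiconcave costs *)

Section min_max.
Variable R : realDomainType.

Lemma ler_dist_min (a x y : R) : `|Num.min a x - Num.min a y| <= `|x - y|.
Proof.
wlog xy : x y / x <= y => [h|].
  by case/orP: (le_total x y) => /h//; rewrite distrC (distrC x).
rewrite distrC (distrC x) [leRHS]ger0_norm ?subr_ge0//.
case: (leP a x) => ax; case: (leP a y) => ay; rewrite ?subrr ?normr0 ?subr_ge0//.
- by have := le_trans ax xy; rewrite leNgt ay.
- by have := ltW ax; rewrite -subr_ge0 => /ger0_norm ->; rewrite lerD2r.
- by rewrite ger0_norm ?subr_ge0.
Qed.

Lemma ler_dist_max (a x y : R) : `|Num.max a x - Num.max a y| <= `|x - y|.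
Proof.
have := ler_dist_min (- a) (- x) (- y).
by rewrite -!oppr_max -!opprD !normrN.
Qed.

End min_max.

Section control_problem.
Variables (R : realType) (d k : nat).
Local Notation mu := (@lebesgue_measure R).
Local Notation int a b f := (Rintegral mu [set` `[a, b]] f).

(** The measure argument of the cost is frozen along the flow and becomes the time variable of [l].
    The Lipschitz constant in [x] carries the weight [1 + |u| ^ 2] because the mixed derivative of
    the cost grows linearly in [u]. *)
Record running_bounds (T C c : R) (l : R -> 'cV[R]_d -> 'cV[R]_k -> R) : Prop := {
  running_bounded : forall s x u, 0 <= s <= T ->
    `|l s x u| <= C * (1 + enorm u ^+ 2);
  running_coercive : forall s x u, 0 <= s <= T -> c * enorm u ^+ 2 - C <= l s x u;
  running_lipx : forall s x y u, 0 <= s <= T ->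
    `|l s x u - l s y u| <= C * (1 + enorm u ^+ 2) * `|x - y|;
  running_lipt : forall s r x u, 0 <= s <= T -> 0 <= r <= T ->
    `|l s x u - l r x u| <= C * `|s - r|;
  running_semiconcave : forall s x y u, 0 <= s <= T ->
    l s (x + y) u + l s (x - y) u - 2 * l s x u <= C * `|y| ^+ 2;
  running_continuous : forall s x, 0 <= s <= T -> continuous (l s x) }.

Record terminal_bounds (C : R) (G : 'cV[R]_d -> R) : Prop := {
  final_bounded : forall x, `|G x| <= C;
  final_lip : forall x y, `|G x - G y| <= C * `|x - y|;
  final_semiconcave : forall x y,
    G (x + y) + G (x - y) - 2 * G x <= C * `|y| ^+ 2 }.

Section fixed_costs.
Variables (T C c : R) (l : R -> 'cV[R]_d -> 'cV[R]_k -> R).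
Variables (T0 : 0 <= T) (C0 : 0 <= C) (hl : running_bounds T C c l).
Implicit Types (g p q : R -> 'cV[R]_d) (u v : R -> 'cV[R]_k).

(** Projection of the time onto [[0, T]]. It extends the cost to all times without losing
    continuity, so that [measurable_continuous_comp] applies on the whole space. *)
Let clamp (s : R) : R := Num.max 0 (Num.min T s).

Let clamp_itv s : 0 <= clamp s <= T.
Proof. by rewrite /clamp le_max lexx/= ge_max T0/= ge_min lexx. Qed.

Let clampE s : 0 <= s <= T -> clamp s = s.
Proof. by move=> /andP[s0 sT]; rewrite /clamp (min_idPr sT) (max_idPr s0). Qed.

Let clamp_lip s r : `|clamp s - clamp r| <= `|s - r|.
Proof.
by rewrite /clamp (le_trans (ler_dist_max _ _ _))// ler_dist_min.
Qed.

(** Joint continuity from separate information: time and position are moved at a Lipschitz price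
    that stays locally bounded in the control, after which only continuity in the control at the
    fixed pair [(clamp s0, x0)] is left. The sum of squares stands for the squared Euclidean norm,
    so that the limit can be taken coordinatewise. *)
Let running_cvg (W : Type) (F : set_system W) (FF : ProperFilter F)
    (S : W -> R) (X : W -> 'cV[R]_d) (U : W -> 'cV[R]_k)
    (s0 : R) (x0 : 'cV[R]_d) (u0 : 'cV[R]_k) :
  S @ F --> s0 -> X @ F --> x0 -> U @ F --> u0 ->
  (fun w => l (clamp (S w)) (X w) (U w)) @ F --> l (clamp s0) x0 u0.
Proof.
move=> cS cX cU.
have dist0 (V : normedModType R) (Y : W -> V) y :
    Y @ F --> y -> (fun w => `|Y w - y|) @ F --> (0 : R).
  move=> Yy; rewrite -(normr0 V) -(subrr y).
  by apply: cvg_norm; apply: cvgB => //; exact: cvg_cst.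
pose bd w := C * `|S w - s0| + C * (1 + \sum_j U w j 0 ^+ 2) * `|X w - x0|
    + `|l (clamp s0) x0 (U w) - l (clamp s0) x0 u0|.
have bd0 : bd @ F --> (0 : R).
  have cb1 : (fun w => C * `|S w - s0|) @ F --> (0 : R).
    by rewrite -[X in _ --> X](mulr0 C); apply: cvgMr; exact: dist0.
  have cb2 : (fun w => C * (1 + \sum_j U w j 0 ^+ 2) * `|X w - x0|) @ F
      --> (0 : R).
    rewrite -[X in _ --> X](mulr0 (C * (1 + \sum_j u0 j 0 ^+ 2))).
    apply: cvgM; last exact: dist0.
    apply: cvgMr; apply: cvgD; first exact: cvg_cst.
    apply: cvgr_sum => j.
    have cj : (fun w => U w j 0) @ F --> u0 j 0.
      apply: (cvg_comp U (fun v : 'cV[R]_k => v j 0) cU).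
      exact: (@coord_continuous R k 1 j 0 u0).
    exact: (cvgM cj cj).
  have cb3 : (fun w => `|l (clamp s0) x0 (U w) - l (clamp s0) x0 u0|) @ F
      --> (0 : R).
    apply: dist0; apply: (cvg_comp U (l (clamp s0) x0) cU).
    exact: (running_continuous hl).
  rewrite -[X in _ --> X]addr0 -[X in _ --> X + _]addr0.
  by apply: cvgD => //; exact: cvgD.
apply/cvgrPdist_le => e e0; move/cvgrPdist_le : bd0 => /(_ _ e0).
apply: filterS => w1; rewrite sub0r normrN; apply: le_trans.
rewrite distrC (le_trans _ (ler_norm _))// /bd.
rewrite -(subrKA (l (clamp s0) (X w1) (U w1))) (le_trans (ler_normD _ _))//.
rewrite -addrA lerD//.
  rewrite (le_trans (running_lipt hl _ _ (clamp_itv _) (clamp_itv _)))//.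
  by rewrite ler_wpM2l.
rewrite -(subrKA (l (clamp s0) x0 (U w1))) (le_trans (ler_normD _ _))//.
by rewrite lerD2r -sqr_enorm; exact: (running_lipx hl _ _ _ (clamp_itv _)).
Qed.

Lemma running_itg (a b : R) g u : 0 <= a -> b <= T ->
  {within `[a, b], continuous g} -> L2_control a b u ->
  itv_integrable a b (fun s => l s (g s) (u s)).
Proof.
move=> a0 bT gc cu; apply: (@itg_le _ _ _ _ (fun s => C * (1 + enorm (u s) ^+ 2))).
(* Time, position and control are stacked into one vector, so that the integrand is a continuous
   function of a vector with measurable coordinates. *)
- pose f (w : 'cV[R]_(1 + (d + k))) : R :=
    l (clamp (usubmx w 0 0)) (usubmx (dsubmx w)) (dsubmx (dsubmx w)).
  pose w (s : R) : 'cV[R]_(1 + (d + k)) :=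
    col_mx (const_mx s) (col_mx (g s) (u s)).
  apply: (@eq_measurable_fun _ _ _ _ _ (fun s => f (w s))).
    move=> s; rewrite inE/= in_itv/= => /andP[as_ sb].
    rewrite /f /w !col_mxKd !col_mxKu mxE clampE//.
    by rewrite (le_trans a0)//= (le_trans sb).
  apply: measurable_continuous_comp => //; last first.
    move=> i; case: (split_ordP i) => j ->.
      apply: (@eq_measurable_fun _ _ _ _ _ id); last exact: measurable_id.
      by move=> s _; rewrite /w col_mxEu mxE.
    case: (split_ordP j) => j' ->.
      apply: (@eq_measurable_fun _ _ _ _ _ (fun s => g s j' 0)).
        by move=> s _; rewrite /w col_mxEd col_mxEu.
      by apply: itg_meas; apply: itg_cont; exact: coord_within.
    apply: eq_measurable_fun (cu.1 j') => s _.
    by rewrite /w col_mxEd col_mxEd.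
  move=> w0; have coord i : (fun w : 'cV[R]_(1 + (d + k)) => w i 0) @ w0 --> w0 i 0.
    exact: coord_continuous.
  have cS : (fun w : 'cV[R]_(1 + (d + k)) => usubmx w 0 0) @ w0
      --> usubmx w0 0 0.
    rewrite mxE; rewrite (_ : (fun w => _) =
      (fun w : 'cV[R]_(1 + (d + k)) => w (lshift (d + k) 0) 0)).
      exact: coord.
    by apply/funext => w1; rewrite mxE.
  have cX : (fun w : 'cV[R]_(1 + (d + k)) => usubmx (dsubmx w)) @ w0
      --> usubmx (dsubmx w0).
    apply: (@cvg_coord R _ (nbhs w0) (nbhs_filter w0)) => i; rewrite !mxE.
    rewrite (_ : (fun w => _) =
      (fun w : 'cV[R]_(1 + (d + k)) => w (rshift 1 (lshift k i)) 0)).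
      exact: coord.
    by apply/funext => w1; rewrite !mxE.
  have cU : (fun w : 'cV[R]_(1 + (d + k)) => dsubmx (dsubmx w)) @ w0
      --> dsubmx (dsubmx w0).
    apply: (@cvg_coord R _ (nbhs w0) (nbhs_filter w0)) => i; rewrite !mxE.
    rewrite (_ : (fun w => _) =
      (fun w : 'cV[R]_(1 + (d + k)) => w (rshift 1 (rshift d i)) 0)).
      exact: coord.
    by apply/funext => w1; rewrite !mxE.
  exact: (@running_cvg _ (nbhs w0) (nbhs_pfilter w0) _ _ _ _ _ _ cS cX cU).
- by move=> s /andP[as_ sb]; apply: (running_bounded hl);
    rewrite (le_trans a0)//= (le_trans sb).
- by apply: itgZ; apply: itgD; [exact: itg_cst|exact: cu.2].
Qed.

End fixed_costs.
End control_problem.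

(** * Energy of near-minimizers *)

Section near_optimal.
Variables (R : realType) (d k : nat) (A : 'M[R]_d) (B : 'M[R]_(d, k)).
Local Notation mu := (@lebesgue_measure R).
Local Notation int a b f := (Rintegral mu [set` `[a, b]] f).
Variables (T C c : R) (l : R -> 'cV[R]_d -> 'cV[R]_k -> R) (G : 'cV[R]_d -> R).
Variables (T0 : 0 <= T) (C0 : 0 <= C) (c0 : 0 < c).
Variables (hl : running_bounds T C c l) (hG : terminal_bounds C G).
Implicit Types (g p q : R -> 'cV[R]_d) (u v : R -> 'cV[R]_k).

Definition energy u (s : R) : R := 1 + enorm (u s) ^+ 2.

Definition admissible_pair (t : R) (x : 'cV[R]_d) u g :=
  [/\ L2_control t T u, solution A B t T u g & g t = x].

Definition payoff (t : R) g u : R := int t T (fun s => l s (g s) (u s)) + G (g T).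

Definition near_minimizer (e t : R) (x : 'cV[R]_d) u g :=
  admissible_pair t x u g /\
  forall u' g', admissible_pair t x u' g' -> payoff t g u <= payoff t g' u' + e.

Lemma energy_itg (a b : R) u : L2_control a b u -> itv_integrable a b (energy u).
Proof. by move=> cu; apply: itgD; [exact: itg_cst|exact: cu.2]. Qed.

Lemma energy_ge0 u s : 0 <= energy u s.
Proof. by rewrite addr_ge0// sqr_ge0. Qed.

Lemma int_energy (a b : R) u : a <= b -> L2_control a b u ->
  int a b (energy u) = (b - a) + int a b (fun s => enorm (u s) ^+ 2).
Proof. by move=> ab cu; rewrite intD ?int_cst ?mul1r//; [exact: itg_cst|exact: cu.2]. Qed.

Lemma running_int_le (a b S : R) g p u : 0 <= a -> a <= b -> b <= T ->
  {within `[a, b], continuous g} -> {within `[a, b], continuous p} -> L2_control a b u ->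
  (forall s, a <= s <= b -> `|g s - p s| <= S) ->
  int a b (fun s => l s (g s) (u s)) <=
  int a b (fun s => l s (p s) (u s)) + C * S * int a b (energy u).
Proof.
move=> a0 ab bT gc pc cu gp.
have ig := running_itg T0 C0 hl a0 bT gc cu.
have ip := running_itg T0 C0 hl a0 bT pc cu.
have ie := energy_itg cu.
rewrite -intZ// -intD//; last exact: itgZ.
apply: int_le => //; first by apply: itgD => //; exact: itgZ.
move=> s sab; have /andP[as_ sb] := sab.
have sT : 0 <= s <= T by rewrite (le_trans a0)//= (le_trans sb).
have := ler_normlW (running_lipx hl (g s) (p s) (u s) sT).
rewrite lerBlDl => /le_trans; apply; rewrite lerD2l -/(energy u s).
by rewrite [leRHS]mulrAC ler_wpM2l ?gp// mulr_ge0// energy_ge0.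
Qed.

(** The bound does not depend on [x], since at zero control both costs are bounded uniformly in the
    position. Set against coercivity, it bounds the total energy of near-minimizers. *)
Lemma zero_admissible (t : R) x : 0 <= t <= T ->
  exists p, admissible_pair t x (fun=> 0) p /\
    payoff t p (fun=> 0) <= C * (T - t) + C.
Proof.
move=> /andP[t0 tT]; have [p [pt tp]] := homogeneous_exists A B x t.
exists p; split; first by split=> //; exact: ctl0.
rewrite lerD//; last exact: ler_normlW (final_bounded hG _).
have ip := running_itg T0 C0 hl t0 (lexx T) (traj_cont (tp T)) (ctl0 _ t T).
rewrite -int_cst//; apply: int_le => //; first exact: itg_cst.
move=> s /andP[ts sT]; rewrite (le_trans (ler_normlW (running_bounded hl _ _ _)))//.
  by rewrite (le_trans t0).
rewrite sqr_enorm big1 ?addr0 ?mulr1// => i _.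
by rewrite mxE expr0n.
Qed.

Lemma payoff_lower (t : R) x u g : 0 <= t <= T -> admissible_pair t x u g ->
  c * int t T (fun s => enorm (u s) ^+ 2) - C * (T - t) - C <= payoff t g u.
Proof.
move=> /andP[t0 tT] [cu tg _]; rewrite lerD//; last first.
  by have := final_bounded hG (g T); rewrite ler_norml => /andP[].
have ig := running_itg T0 C0 hl t0 (lexx T) (traj_cont tg) cu.
rewrite -int_cst// -intZ ?cu.2// -intB; [|exact: itgZ cu.2|exact: itg_cst].
apply: int_le => //; first by apply: itgB; [exact: itgZ cu.2|exact: itg_cst].
move=> s /andP[ts sT]; apply: (running_coercive hl).
by rewrite (le_trans t0).
Qed.

Lemma near_minimizer_energy (e t : R) x u g : 0 <= t <= T ->
  near_minimizer e t x u g ->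
  int t T (energy u) <= T + c^-1 * (2 * C * T + 2 * C + e).
Proof.
move=> tT [ad opt]; have [p [ap pC]] := zero_admissible x tT.
have := le_trans (payoff_lower tT ad) (opt _ _ ap).
have /andP[t0 tT'] := tT; have cu : L2_control t T u by case: ad.
rewrite int_energy//; move: (int t T _) => i2 h.
apply: lerD; first by rewrite lerBlDr lerDl.
rewrite -(ler_pM2l c0) mulrA divff ?gt_eqF// mul1r.
have : C * (T - t) <= C * T by rewrite ler_wpM2l// lerBlDr lerDl.
lra.
Qed.

Lemma payoff_split (t r : R) x u g : 0 <= t -> t <= r -> r <= T ->
  admissible_pair t x u g ->
  payoff t g u = int t r (fun s => l s (g s) (u s)) + payoff r g u.
Proof.
move=> t0 tr rT [cu tg _]; rewrite /payoff addrA -int_cat//.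
exact: (running_itg T0 C0 hl t0 (lexx T) (traj_cont tg) cu).
Qed.

Lemma payoff_splice (r : R) u v g p : 0 <= r -> r <= T -> g r = p r ->
  {within `[r, T], continuous p} -> L2_control r T v ->
  payoff r (splice r g p) (splice r u v) = payoff r p v.
Proof.
move=> r0 rT gp pc cv; congr (_ + _).
  apply/esym; apply: int_eq_oc => [s /andP[rs _]|]; first by rewrite !splice_r.
  exact: (running_itg T0 C0 hl r0 (lexx T) pc cv).
by case: ltgtP rT => // [rT|<-] _; [rewrite splice_r|rewrite splice_l ?gp].
Qed.

Lemma payoff_le (r S : R) u g p : 0 <= r -> r <= T ->
  {within `[r, T], continuous g} -> {within `[r, T], continuous p} -> L2_control r T u ->
  (forall s, r <= s <= T -> `|g s - p s| <= S) ->
  payoff r g u <= payoff r p u + C * S * (int r T (energy u) + 1).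
Proof.
move=> r0 rT gc pc cu gp; rewrite /payoff mulrDr mulr1 addrACA lerD//.
  exact: running_int_le.
rewrite -lerBlDl (le_trans (ler_normlW (final_lip hG _ _)))// ler_wpM2l//.
by rewrite gp// rT lexx.
Qed.

(** Suppressing the control changes the rest of the trajectory by a multiple of the integral of
    [|u|] only, not of [|u| ^ 2]. Young's inequality therefore absorbs the extra cost of the rest
    into half of the coercive term, at a price proportional to [delta]. *)
Lemma near_minimizer_initial_energy (e0 : R) : 0 <= e0 -> exists2 N : R, 0 <= N &
  forall e t delta x u g, 0 <= t -> 0 <= delta -> t + delta <= T -> 0 <= e <= e0 ->
  near_minimizer e t x u g -> int t (t + delta) (energy u) <= N * (delta + e).
Proof.
move=> e00; have [K K0 hK] := traj_bounds A B T0.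
have [K' K'0 hK'] := homogeneous_bounds A B T0.
have ci : 0 <= c^-1 by rewrite invr_ge0 ltW.
(* [M] bounds the total energy of a near-minimizer, and [P] is the Lipschitz constant of the payoff
   after [t + delta] in terms of [i1], the integral of [|u|] over the initial interval. *)
pose M := T + c^-1 * (2 * C * T + 2 * C + e0).
have M0 : 0 <= M.
  by rewrite /M !(addr_ge0, mulr_ge0).
pose P := C * (K' * K) * (M + 1).
have P0 : 0 <= P by rewrite !mulr_ge0// addr_ge0.
exists (1 + 2 / c * (2 * C + P ^+ 2 / (2 * c) + 1)).
  by rewrite invfM !(addr_ge0, mulr_ge0)// ?sqr_ge0// invr_ge0.
move=> e t delta x u g t0 d0 tdT /andP[e_0 ee0] nm.
have ttd : t <= t + delta by rewrite lerDl.
have tT : 0 <= t <= T by rewrite t0 (le_trans ttd).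
have [ad opt] := nm; have [cu tg gx] := ad.
have cu1 : L2_control t (t + delta) u by apply: ctl_sub cu.
have cu2 : L2_control (t + delta) T u by apply: ctl_sub cu.
have tg1 : solution A B t (t + delta) u g by apply: traj_sub tg.
have tg2 : solution A B (t + delta) T u g by apply: traj_sub tg.
have EM : int (t + delta) T (energy u) <= M.
  apply: (@le_trans _ _ (int t T (energy u))).
    rewrite (int_cat ttd tdT (energy_itg cu)) lerDr; apply: int_ge0 => s _.
    exact: energy_ge0.
  apply: (le_trans (near_minimizer_energy tT nm)).
  by rewrite /M lerD2l ler_wpM2l// lerD2l.
have [p [pt tp]] := homogeneous_exists A B x t.
(* [q] starts from the gap between [p] and [g] at [t + delta], so that [g + q] continues [p] with
   the control [u]. *)
have [q [qt tq]] := homogeneous_exists A B (p (t + delta) - g (t + delta)) (t + delta).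
have ad' : admissible_pair t x (splice (t + delta) (fun=> 0) u)
    (splice (t + delta) p (fun s => g s + 1 *: q s)).
  split.
  - by apply: ctl_splice => //; exact: ctl0.
  - apply: traj_splice => //; first exact: ctl0.
      exact: traj_add (tq T).
    by rewrite qt scale1r addrCA subrr addr0.
  - by rewrite splice_l.
set i1 := int t (t + delta) (fun s => enorm (u s)).
set i2 := int t (t + delta) (fun s => enorm (u s) ^+ 2).
have i10 : 0 <= i1 by apply: int_ge0 => s _; exact: enorm_ge0.
have qK : forall s, t + delta <= s <= T -> `|q s| <= K' * K * i1.
  move=> s sT; have sb : T - (t + delta) <= T by rewrite lerBlDr lerDl addr_ge0.
  have [+ _] := hK' _ _ _ tdT sb (tq T) s sT.
  move=> /le_trans; apply; rewrite -mulrA ler_wpM2l// qt.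
  (* The difference [g - p] has control [u] and initial value [0], so its size at [t + delta] is
     controlled by [i1] alone. *)
  have ty : solution A B t (t + delta) u (fun s => g s + (-1) *: p s).
    exact: traj_add (tp _).
  have db : t + delta - t <= T by rewrite lerBlDr (le_trans tdT)// lerDl.
  have := hK _ _ _ _ ttd db cu1 ty (t + delta).
  rewrite gx pt !scaleN1r subrr normr0 add0r distrC; apply.
  by rewrite ttd lexx.
have h := opt _ _ ad'.
rewrite (payoff_split t0 ttd tdT ad) (payoff_split t0 ttd tdT ad') in h.
have icst z : z * delta = int t (t + delta) (fun=> z).
  by rewrite int_cst// addrAC subrr add0r.
have h1 : c * i2 - C * delta <= int t (t + delta) (fun s => l s (g s) (u s)).
  have ig := running_itg T0 C0 hl t0 tdT (traj_cont tg1) cu1.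
  rewrite (icst C) -intZ ?cu1.2//.
  rewrite -intB; [|exact: itgZ cu1.2|exact: itg_cst].
  apply: int_le => //; first by apply: itgB; [exact: itgZ cu1.2|exact: itg_cst].
  move=> s /andP[ts sT]; apply: (running_coercive hl).
  by rewrite (le_trans t0)// (le_trans sT).
have h2 : int t (t + delta) (fun s => l s (splice (t + delta) p
    (fun s => g s + 1 *: q s) s) (splice (t + delta) (fun=> 0) u s)) <= C * delta.
  have cs : L2_control t (t + delta) (splice (t + delta) (fun=> 0) u).
    by case: ad' => [c' _ _]; apply: ctl_sub c'.
  have ig := running_itg T0 C0 hl t0 tdT (traj_cont (tp (t + delta))) (ctl0 _ _ _).
  rewrite (icst C).
  rewrite (@int_eq _ _ _ _ (fun s => l s (p s) 0)); last first.
    by move=> s /andP[_ sd]; rewrite !splice_l.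
  apply: int_le => //; first exact: itg_cst.
  move=> s /andP[ts sT]; rewrite (le_trans (ler_normlW (running_bounded hl _ _ _)))//.
    by rewrite (le_trans t0)// (le_trans sT).
  rewrite sqr_enorm big1 ?addr0 ?mulr1// => i _.
  by rewrite mxE expr0n.
have h3 : payoff (t + delta) (splice (t + delta) p (fun s => g s + 1 *: q s))
    (splice (t + delta) (fun=> 0) u) <= payoff (t + delta) g u + P * i1.
  rewrite payoff_splice ?(le_trans t0)//; last 2 first.
  - by rewrite qt scale1r addrCA subrr addr0.
  - by case: (traj_add 1 cu2 tg2 (tq T)).
  have S0 : 0 <= K' * K * i1 by rewrite !mulr_ge0.
  apply: le_trans (payoff_le (p := g) (S := K' * K * i1) _ _ _ _ _ _) _ => //.
  - by rewrite (le_trans t0).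
  - by case: (traj_add 1 cu2 tg2 (tq T)).
  - exact: traj_cont tg2.
  - by move=> s /qK; rewrite scale1r addrAC subrr add0r.
  rewrite lerD2l /P mulrA -!mulrA ler_wpM2l// !mulrA.
  rewrite [leRHS]mulrAC ler_wpM2l// lerD2r//.
(* Young's inequality under the integral, by completing the square. *)
have h4 : P * i1 <= c / 2 * i2 + P ^+ 2 / (2 * c) * delta.
  rewrite (icst (P ^+ 2 / (2 * c))) -[P * i1]intZ; last exact: ctl_enorm.
  rewrite -[c / 2 * i2]intZ; last exact: cu1.2.
  rewrite -intD; [|exact: itgZ cu1.2|exact: itg_cst].
  apply: int_le; first by apply: itgZ; exact: ctl_enorm.
    by apply: itgD; [exact: itgZ cu1.2|exact: itg_cst].
  move=> s _; rewrite -subr_ge0.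
  have -> : c / 2 * enorm (u s) ^+ 2 + P ^+ 2 / (2 * c) - P * enorm (u s) =
    (2 * c)^-1 * (c * enorm (u s) - P) ^+ 2.
    by field; rewrite gt_eqF.
  by rewrite mulr_ge0 ?sqr_ge0// invr_ge0 mulr_ge0// ltW.
rewrite int_energy// -/i2 (_ : t + delta - t = delta); last by ring.
have h5 : c / 2 * i2 <= (2 * C + P ^+ 2 / (2 * c) + 1) * (delta + e).
  have : 0 <= P ^+ 2 / (2 * c) by rewrite divr_ge0 ?sqr_ge0// mulr_ge0// ltW.
  move: (P ^+ 2 / (2 * c)) h4 => z h4 z0.
  have := mulr_ge0 z0 e_0; have := mulr_ge0 C0 e_0; lra.
rewrite mulrDl mul1r lerD//; first by rewrite lerDl.
rewrite -[_ * _ * (delta + e)]mulrA -[i2](@mulKf _ (c / 2)); last first.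
  by rewrite mulf_neq0 ?gt_eqF.
by rewrite invf_div ler_wpM2l// divr_ge0// ltW.
Qed.

End near_optimal.

(** * Second differences of the payoff *)

Section semiconcave_payoff.
Variables (R : realType) (d k : nat) (A : 'M[R]_d) (B : 'M[R]_(d, k)).
Local Notation mu := (@lebesgue_measure R).
Local Notation int a b f := (Rintegral mu [set` `[a, b]] f).
Variables (T C c : R) (l : R -> 'cV[R]_d -> 'cV[R]_k -> R) (G : 'cV[R]_d -> R).
Variables (T0 : 0 <= T) (C0 : 0 <= C) (c0 : 0 < c).
Variables (hl : running_bounds T C c l) (hG : terminal_bounds C G).
Implicit Types (g p q : R -> 'cV[R]_d) (u v : R -> 'cV[R]_k).

(** Semiconcavity is applied at the midpoint [x + (y + z) / 2] with increment [(y - z) / 2], and the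
    Lipschitz bound moves the midpoint back to [x]. Increments that are not exactly opposite are
    thus allowed, at a first-order price in [y + z]. *)
Lemma semiconcave_lipschitz_le (f : 'cV[R]_d -> R) (a b : R) : 0 <= b ->
  (forall x y, `|f x - f y| <= a * `|x - y|) ->
  (forall x y, f (x + y) + f (x - y) - 2 * f x <= b * `|y| ^+ 2) ->
  forall x y z, f (x + y) + f (x + z) <=
    2 * f x + a * `|y + z| + b * `|y - z| ^+ 2.
Proof.
move=> b0 fl fs x y z.
have := fs (x + 2^-1 *: (y + z)) (2^-1 *: (y - z)).
have -> : x + 2^-1 *: (y + z) + 2^-1 *: (y - z) = x + y.
  by apply/colP => i; rewrite !mxE; field.
have -> : x + 2^-1 *: (y + z) - 2^-1 *: (y - z) = x + z.
  by apply/colP => i; rewrite !mxE; field.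
have := fl (x + 2^-1 *: (y + z)) x; rewrite addrAC subrr add0r.
rewrite !normrZ ger0_norm ?invr_ge0// exprMn => /ler_normlW h1 h2.
have := mulr_ge0 b0 (sqr_ge0 `|y - z|); lra.
Qed.

(** [semiconcave_lipschitz_le] integrated along the curve. The asymmetry [S2] is multiplied by the
    energy, the weight of the Lipschitz bound; the spread [S1] is multiplied only by the elapsed
    time. *)
Lemma payoff_semiconcave (r S1 S2 : R) u g p q : 0 <= r -> r <= T ->
  {within `[r, T], continuous g} -> {within `[r, T], continuous p} ->
  {within `[r, T], continuous q} -> L2_control r T u -> 
  (forall s, r <= s <= T -> `|p s - q s| <= S1 /\ `|p s + q s| <= S2) ->
  payoff T l G r (fun s => g s + 1 *: p s) u +
  payoff T l G r (fun s => g s + 1 *: q s) u <= 2 * payoff T l G r g u +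
    C * S2 * (int r T (energy u) + 1) + C * S1 ^+ 2 * (T - r + 1).
Proof.
move=> r0 rT gc pc qc cu pq.
have gpc : {within `[r, T], continuous (fun s => g s + 1 *: p s)}.
  by move=> s; apply: cvgD; [exact: gc|apply: cvgZr; exact: pc].
have gqc : {within `[r, T], continuous (fun s => g s + 1 *: q s)}.
  by move=> s; apply: cvgD; [exact: gc|apply: cvgZr; exact: qc].
have ig := running_itg T0 C0 hl r0 (lexx T) gc cu.
have igp := running_itg T0 C0 hl r0 (lexx T) gpc cu.
have igq := running_itg T0 C0 hl r0 (lexx T) gqc cu.
have ie := energy_itg cu.
have S10 : 0 <= S1.
  by have [+ _] := pq r (introT andP (conj (lexx r) rT)); apply: le_trans.
have sq s : r <= s <= T -> C * `|p s - q s| ^+ 2 <= C * S1 ^+ 2.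
  by move=> /pq[h _]; rewrite ler_wpM2l// lerXn2r// nnegrE.
have hG' : G (g T + 1 *: p T) + G (g T + 1 *: q T) <=
    2 * G (g T) + C * S2 + C * S1 ^+ 2.
  have TT : r <= T <= T by rewrite rT lexx.
  have := semiconcave_lipschitz_le C0 (final_lip hG) (final_semiconcave hG)
    (g T) (p T) (q T); rewrite !scale1r => /le_trans; apply.
  by rewrite -!addrA lerD2l lerD// ?sq// ler_wpM2l//; case: (pq T TT).
have hl' : int r T (fun s => l s (g s + 1 *: p s) (u s)) +
    int r T (fun s => l s (g s + 1 *: q s) (u s)) <=
    2 * int r T (fun s => l s (g s) (u s)) + C * S2 * int r T (energy u) +
    C * S1 ^+ 2 * (T - r).
  rewrite -int_cst// -!intZ// -!intD//; try (by apply: itg_cst);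
    try (by apply: itgZ); try (by apply: itgD; exact: itgZ).
  apply: int_le; first exact: itgD.
    by apply: itgD; [apply: itgD; exact: itgZ|exact: itg_cst].
  move=> s sr; have sT : 0 <= s <= T.
    by move: sr => /andP[rs ->]; rewrite (le_trans r0).
  have := semiconcave_lipschitz_le C0 (fun x y => running_lipx hl x y (u s) sT)
    (fun x y => running_semiconcave hl x y (u s) sT) (g s) (p s) (q s).
  rewrite !scale1r => /le_trans; apply; rewrite -!addrA lerD2l lerD ?sq//.
  rewrite [leRHS]mulrAC ler_wpM2l ?mulr_ge0 ?energy_ge0//.
  by case: (pq s sr).
rewrite /payoff; move: hG' hl'; move: (int r T (energy u)) (S1 ^+ 2) => E S.
lra.
Qed.

Lemma near_minimizer_semiconcave (e0 rho : R) : 0 <= e0 -> 0 <= rho ->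
  exists2 La : R, 0 <= La & forall e t delta x h u g, 0 <= e <= e0 -> 0 <= delta ->
  0 <= t - delta -> t + delta <= T -> `|x| <= rho ->
  near_minimizer A B T l G e t x u g ->
  exists up gp um gm, [/\ admissible_pair A B T (t + delta) (x + h) up gp,
    admissible_pair A B T (t - delta) (x - h) um gm &
    payoff T l G (t + delta) gp up + payoff T l G (t - delta) gm um <=
      2 * payoff T l G t g u + La * (`|h| + delta + e) ^+ 2].
Proof.
move=> e00 rho0; have [K K0 hK] := traj_bounds A B T0.
have [K' K'0 hK'] := homogeneous_bounds A B T0.
have [N N0 hN] := near_minimizer_initial_energy A B T0 C0 c0 hl hG e00.
pose M := T + c^-1 * (2 * C * T + 2 * C + e0).
have ci : 0 <= c^-1 by rewrite invr_ge0 ltW.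
have M0 : 0 <= M by rewrite /M !(addr_ge0, mulr_ge0).
(* In units of [sg], [D] bounds the displacement [Dl], [D2] the correction [q2], and [D1] the
   difference [qp - q2]. In units of [sg ^ 2], [D2] also bounds the increment of [q2] over
   [[t, t + delta]], and [D3] the sum [qp + q2]. *)
pose D := K * N + K' * rho.
have D0 : 0 <= D by rewrite /D !(addr_ge0, mulr_ge0).
pose D2 := K' * (D + K').
have D20 : 0 <= D2 by rewrite /D2 !(addr_ge0, mulr_ge0).
pose D1 := K' * (1 + D) + D2.
have D10 : 0 <= D1 by rewrite /D1 !(addr_ge0, mulr_ge0).
pose D3 := K' * (D2 + K').
have D30 : 0 <= D3 by rewrite /D3 !(addr_ge0, mulr_ge0).
exists (C + C * K' * N + C * D2 * N + C * D3 * (M + 1) + C * D1 ^+ 2 * (T + 1)).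
  by rewrite !(addr_ge0, mulr_ge0)// sqr_ge0.
move=> e t delta x h u g /andP[e_0 ee0] d0 td0 tdT xr nm.
set sg := `|h| + delta + e.
have sg0 : 0 <= sg by rewrite /sg !addr_ge0.
have hsg : `|h| <= sg by rewrite /sg -addrA lerDl addr_ge0.
have dsg : delta <= sg by rewrite /sg addrAC lerDr addr_ge0.
have desg : delta + e <= sg by rewrite /sg -addrA lerDr.
have t0 : 0 <= t by rewrite (le_trans td0)// lerBlDr lerDl.
have ttd : t <= t + delta by rewrite lerDl.
have tdt : t - delta <= t by rewrite lerBlDr lerDl.
have tT' : t <= T by rewrite (le_trans ttd).
have tT : 0 <= t <= T by rewrite t0.
have td_0 : 0 <= t + delta by rewrite addr_ge0.
have [ad opt] := nm; have [cu tg gx] := ad.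
have cu1 : L2_control t (t + delta) u by apply: ctl_sub cu.
have cu2 : L2_control (t + delta) T u by apply: ctl_sub cu.
have tg1 : solution A B t (t + delta) u g by apply: traj_sub tg.
have tg2 : solution A B (t + delta) T u g by apply: traj_sub tg.
have EN : int t (t + delta) (energy u) <= N * sg.
  apply: le_trans (hN e t delta x u g t0 d0 tdT _ nm) _; first by rewrite e_0.
  by rewrite ler_wpM2l.
have EM : int (t + delta) T (energy u) <= M.
  apply: (@le_trans _ _ (int t T (energy u))).
    rewrite (int_cat ttd tdT (energy_itg cu)) lerDr; apply: int_ge0 => s _.
    exact: energy_ge0.
  apply: (le_trans (near_minimizer_energy T0 C0 c0 hl hG tT nm)).
  by rewrite /M lerD2l ler_wpM2l// lerD2l.
have lenT a b : 0 <= a -> b <= T -> b - a <= T.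
  by move=> a0 bT; rewrite lerBlDr (le_trans bT)// lerDl.
pose Dl := g (t + delta) - x.
have Dl_le : `|Dl| <= D * sg.
  (* Split at the homogeneous solution from [x]: [g - p] is bounded by the integral of [|u|], hence
     by the initial energy, and [p - x] by [K' * delta * |x|], which is where the constant depends
     on [rho]. *)
  have [p [pt tp]] := homogeneous_exists A B x t.
  have ty : solution A B t (t + delta) u (fun s => g s + (-1) *: p s).
    exact: traj_add (tp _).
  have tdin : t <= t + delta <= t + delta by rewrite ttd lexx.
  have h1 := hK _ _ _ _ ttd (lenT _ _ t0 tdT) cu1 ty _ tdin.
  rewrite gx pt !scaleN1r subrr normr0 add0r in h1.
  have [_] := hK' _ _ _ ttd (lenT _ _ t0 tdT) (tp _) _ tdin.
  rewrite pt => h2.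
  rewrite /Dl -(subrKA (p (t + delta))) (le_trans (ler_normD _ _))// /D mulrDl.
  apply: lerD.
    apply: (le_trans h1); rewrite -mulrA ler_wpM2l//; apply: le_trans EN.
    apply: int_le; [exact: ctl_enorm|exact: energy_itg|].
    by move=> s _; rewrite /energy; have := sqr_ge0 (enorm (u s) - 1); nra.
  apply: (le_trans h2); rewrite (_ : t + delta - t = delta); last by ring.
  by rewrite -!mulrA ler_wpM2l// mulrC ler_pM.
(* [qp] moves [g (t + delta)] to [x + h]. [q1] moves the shifted copy of [g], which is at [x] at
   time [t - delta], to [x - h]. At time [t] that piece has reached [x + Dl + q1 t], so [q2] takes
   over the offset [Dl + q1 t] from [g]. *)
have [qp [qp0 tqp]] := homogeneous_exists A B (h - Dl) (t + delta).
have [q1 [q10 tq1]] := homogeneous_exists A B (- h) (t - delta).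
have [q2 [q20 tq2]] := homogeneous_exists A B (Dl + q1 t) t.
have qp_le s : t + delta <= s <= T -> `|qp s| <= K' * (1 + D) * sg.
  move=> sT; have [+ _] := hK' _ _ _ tdT (lenT _ _ td_0 (lexx T)) (tqp T) _ sT.
  move=> /le_trans; apply; rewrite -mulrA ler_wpM2l// qp0 mulrDl mul1r.
  by rewrite (le_trans (ler_normB _ _))// lerD.
have q1_le s : t - delta <= s <= t -> `|q1 s| <= K' * sg.
  move=> st; have [+ _] := hK' _ _ _ tdt (lenT _ _ td0 tT') (tq1 t) _ st.
  by move=> /le_trans; apply; rewrite ler_wpM2l// q10 normrN.
have tint : t - delta <= t <= t by rewrite tdt lexx.
have q1t : `|q1 t + h| <= K' * sg ^+ 2.
  have [_] := hK' _ _ _ tdt (lenT _ _ td0 tT') (tq1 t) _ tint.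
  rewrite q10 opprK normrN => /le_trans; apply.
  rewrite (_ : t - (t - delta) = delta); last by ring.
  by rewrite -mulrA ler_wpM2l// expr2 ler_pM.
have q20_le : `|q2 t| <= (D + K') * sg.
  rewrite q20 (le_trans (ler_normD _ _))// mulrDl lerD//.
  exact: q1_le.
have q2_le s : t <= s <= T -> `|q2 s| <= D2 * sg.
  move=> sT; have [+ _] := hK' _ _ _ tT' (lenT _ _ t0 (lexx T)) (tq2 T) _ sT.
  by move=> /le_trans; apply; rewrite /D2 -mulrA ler_wpM2l.
have q2d : `|q2 (t + delta) - q2 t| <= D2 * sg ^+ 2.
  have tdin : t <= t + delta <= T by rewrite ttd.
  have [_] := hK' _ _ _ tT' (lenT _ _ t0 (lexx T)) (tq2 T) _ tdin.
  move=> /le_trans; apply; rewrite (_ : t + delta - t = delta); last by ring.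
  rewrite /D2 expr2 -!mulrA ler_wpM2l// [leRHS]mulrCA ler_pM//.
have tq2' : solution A B (t + delta) T (fun=> 0) q2.
  by apply: traj_sub (ctl0 _ t T) (tq2 T).
have tr : solution A B (t + delta) T (fun=> 0) (fun s => q2 s + 1 *: qp s).
  exact: traj_add (ctl0 _ _ _) tq2' (tqp T).
(* The increment [Dl], of first order only, cancels in [q2 + qp]. *)
have sum_le s : t + delta <= s <= T -> `|qp s + q2 s| <= D3 * sg ^+ 2.
  move=> sT; have [+ _] := hK' _ _ _ tdT (lenT _ _ td_0 (lexx T)) tr _ sT.
  rewrite !scale1r addrC => /le_trans; apply; rewrite /D3 -mulrA ler_wpM2l//.
  have -> : q2 (t + delta) + qp (t + delta) =
      (q2 (t + delta) - q2 t) + (q1 t + h).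
    rewrite qp0 q20; apply/colP => i; rewrite !mxE; ring.
  by rewrite (le_trans (ler_normD _ _))// mulrDl lerD.
have cus : L2_control (t - delta) t (fun s => u (s + delta)).
  by apply: ctl_shift; rewrite subrK.
have tgs : solution A B (t - delta) t (fun s => u (s + delta)) (fun s => g (s + delta)).
  by apply: traj_shift; rewrite subrK.
have tm1 := traj_add 1 cus tgs (tq1 t).
have tm2 := traj_add 1 cu tg (tq2 T).
pose g1 := fun s => g (s + delta) + 1 *: q1 s.
pose g2 := fun s => g s + 1 *: q2 s.
have g12 : g1 t = g2 t.
  by rewrite /g1 /g2 !scale1r q20 gx /Dl; apply/colP => i; rewrite !mxE; ring.
have adp : admissible_pair A B T (t + delta) (x + h) u (fun s => g s + 1 *: qp s).
  split=> //; first exact: traj_add (tqp T).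
  by rewrite scale1r qp0 /Dl; apply/colP => i; rewrite !mxE; ring.
have adm : admissible_pair A B T (t - delta) (x - h)
    (splice t (fun s => u (s + delta)) u) (splice t g1 g2).
  split; [exact: ctl_splice|exact: traj_splice|].
  by rewrite splice_l// /g1 scale1r q10 subrK gx.
exists u, (fun s => g s + 1 *: qp s), (splice t (fun s => u (s + delta)) u),
  (splice t g1 g2); split=> //.
have ad2 : admissible_pair A B T t (x + q2 t) u g2.
  by split=> //; rewrite /g2 scale1r gx.
rewrite (payoff_split G T0 C0 hl td0 tdt tT' adm).
rewrite (payoff_splice G T0 C0 hl _ t0 tT' g12 (traj_cont tm2) cu).
rewrite (payoff_split G T0 C0 hl t0 ttd tdT ad2).
rewrite (payoff_split G T0 C0 hl t0 ttd tdT ad).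
have tdd : t - delta + delta = t by rewrite subrK.
have ig := running_itg T0 C0 hl t0 tdT (traj_cont tg1) cu1.
have ie := energy_itg cu1.
(* The cost along [g] plus the two errors made on [[t - delta, t]]: reading the cost at a time
   [delta] later, and dropping the correction [q1]. *)
pose F s := l s (g s) (u s) + (C * delta + C * (K' * sg) * energy u s).
have iF : itv_integrable t (t + delta) F.
  by apply: itgD => //; apply: itgD; [exact: itg_cst|exact: itgZ].
(* A position error [z * sg] meets an energy at most [N * sg] on the short interval, so the product
   is of second order. *)
have key z : 0 <= z ->
    C * (z * sg) * int t (t + delta) (energy u) <= C * z * N * sg ^+ 2.
  move=> z0; rewrite (_ : C * z * N * sg ^+ 2 = C * (z * sg) * (N * sg)).
    by rewrite ler_wpM2l// !mulr_ge0.
  by ring.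
have h1 : int (t - delta) t (fun s => l s (splice t g1 g2 s)
      (splice t (fun s => u (s + delta)) u s)) <=
    int t (t + delta) (fun s => l s (g s) (u s)) + C * sg ^+ 2 +
    C * K' * N * sg ^+ 2.
  rewrite (@int_eq _ _ _ _ (fun s => l s (g1 s) (u (s + delta)))); last first.
    by move=> s /andP[_ st]; rewrite !splice_l.
  apply: (@le_trans _ _ (int (t - delta) t (fun s => F (s + delta)))).
    apply: int_le.
    - exact: (running_itg T0 C0 hl td0 tT' (traj_cont tm1) cus).
    - by apply: itg_shift; rewrite tdd.
    - move=> s sI; have /andP[s1 s2] := sI.
      have sT : 0 <= s <= T by rewrite (le_trans td0)// (le_trans s2).
      have sdT : 0 <= s + delta <= T.
        rewrite addr_ge0 ?(le_trans td0 s1)//=.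
        by apply: le_trans tdT; rewrite lerD2r.
      have a1 := ler_normlW (running_lipt hl (g1 s) (u (s + delta)) sT sdT).
      have a2 := ler_normlW (running_lipx hl (g1 s) (g (s + delta))
        (u (s + delta)) sdT).
      rewrite /F; rewrite distrC (_ : s + delta - s = delta) in a1; last by ring.
      rewrite (ger0_norm d0) in a1.
      have a3 : C * (1 + enorm (u (s + delta)) ^+ 2) * `|g1 s - g (s + delta)| <=
          C * (K' * sg) * energy u (s + delta).
        rewrite [leRHS]mulrAC ler_wpM2l ?mulr_ge0 ?energy_ge0//.
        by rewrite /g1 scale1r addrAC subrr add0r q1_le.
      by move: a1 a2 a3; lra.
  rewrite (@int_shift _ _ _ _ F) ?tdd// intD//; last first.
    by apply: itgD; [exact: itg_cst|exact: itgZ].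
  rewrite -addrA lerD2l intD; [|exact: itg_cst|exact: itgZ].
  rewrite int_cst// intZ// lerD//.
    rewrite (_ : t + delta - t = delta); last by ring.
    by rewrite -mulrA ler_wpM2l// expr2 ler_pM.
  exact: key.
have h2 : int t (t + delta) (fun s => l s (g2 s) (u s)) <=
    int t (t + delta) (fun s => l s (g s) (u s)) + C * D2 * N * sg ^+ 2.
  apply: le_trans (running_int_le T0 C0 hl (S := D2 * sg) t0 ttd tdT _
    (traj_cont tg1) cu1 _) _.
  - exact: within_sub (lexx t) tdT (traj_cont tm2).
  - move=> s /andP[s1 s2]; rewrite /g2 scale1r addrAC subrr add0r q2_le// s1.
    by rewrite (le_trans s2).
  by rewrite lerD2l; exact: key.
have h3 := @payoff_semiconcave (t + delta) (D1 * sg) (D3 * sg ^+ 2) u g qp q2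
  td_0 tdT (traj_cont tg2) (traj_cont (tqp T)) (traj_cont tq2') cu2.
have {}h3 : payoff T l G (t + delta) (fun s => g s + 1 *: qp s) u +
    payoff T l G (t + delta) g2 u <= 2 * payoff T l G (t + delta) g u +
    C * D3 * (M + 1) * sg ^+ 2 + C * D1 ^+ 2 * (T + 1) * sg ^+ 2.
  have b1 : C * (D3 * sg ^+ 2) * (int (t + delta) T (energy u) + 1) <=
      C * D3 * (M + 1) * sg ^+ 2.
    rewrite (_ : C * D3 * (M + 1) * sg ^+ 2 = C * (D3 * sg ^+ 2) * (M + 1)).
      apply: ler_wpM2l; last by rewrite lerD2r.
      by apply: mulr_ge0 => //; apply: mulr_ge0 => //; exact: sqr_ge0.
    by ring.
  have b2 : C * (D1 * sg) ^+ 2 * (T - (t + delta) + 1) <=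
      C * D1 ^+ 2 * (T + 1) * sg ^+ 2.
    rewrite (_ : C * D1 ^+ 2 * (T + 1) * sg ^+ 2 = C * (D1 * sg) ^+ 2 * (T + 1)).
      apply: ler_wpM2l; last by rewrite lerD2r lerBlDr lerDl.
      by apply: mulr_ge0 => //; exact: sqr_ge0.
    by ring.
  apply: le_trans (h3 _) (lerD (lerD (lexx _) b1) b2).
  move=> s sT; split; last exact: sum_le.
  rewrite (le_trans (ler_normB _ _))// /D1 mulrDl lerD ?qp_le//.
  by apply: q2_le; case/andP: sT => s1 ->; rewrite (le_trans ttd).
by move: h1 h2 h3; rewrite !mulrDl; lra.
Qed.

End semiconcave_payoff.

(** * Estimates on the costs *)

Lemma mean_value_unit (R : realType) (F dF : R -> R) :
  (forall s, is_derive s (1 : R) F (dF s)) ->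
  exists2 s : R, 0 <= s <= 1 & F 1 - F 0 = dF s.
Proof.
move=> FdF; have [|s] := @MVT_segment _ F dF 0 1 ler01 (fun s _ => FdF s).
  apply: continuous_subspaceT => s.
  have [/derivable1_diffP/differentiable_continuous] := FdF s.
  exact.
by rewrite in_itv/= subr0 mulr1 => s01 ->; exists s.
Qed.

Section directional_derivatives.
Variables (R : realType) (V : normedModType R).
Implicit Types (f : V -> R) (z v : V).

Lemma is_derive_line f z v (s : R) : differentiable f (z + s *: v) ->
  is_derive s (1 : R) (fun r : R => f (z + r *: v)) ('D_v f (z + s *: v)).
Proof.
move=> df; have E : (fun h : R => h^-1 *:
    (((fun r : R => f (z + r *: v)) \o shift s) (h *: (1 : R)) - f (z + s *: v))) =
    (fun h : R => h^-1 *: ((f \o shift (z + s *: v)) (h *: v) - f (z + s *: v))).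
  apply/funext => h; congr (_ *: (f _ - _)) => /=.
  have -> : h *: (1 : R) + s = h + s by congr (_ + s); exact: mulr1.
  rewrite scalerDl addrCA; reflexivity.
apply: DeriveDef.
  rewrite /derivable E; exact: diff_derivable.
rewrite /derive E; reflexivity.
Qed.

Lemma mean_value_line f z v : (forall y, differentiable f y) ->
  exists2 s : R, 0 <= s <= 1 & f (z + v) - f z = 'D_v f (z + s *: v).
Proof.
move=> df; have [s s01] := mean_value_unit (fun s => is_derive_line (df (z + s *: v))).
by rewrite scale1r scale0r addr0 => ->; exists s.
Qed.

Lemma derive_linear_sum (I : finType) f z (c : I -> R) (v : I -> V) :
  differentiable f z ->
  'D_(\sum_i c i *: v i) f z = \sum_i c i * 'D_(v i) f z.
Proof.
move=> df; rewrite deriveE// linear_sum; apply: eq_bigr => i _.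
by rewrite linearZ/= deriveE.
Qed.

End directional_derivatives.

Section cost_estimates.
Variables (R : realType) (d k : nat).
Implicit Types (x y : 'cV[R]_d) (u : 'cV[R]_k).

Lemma enormZ (n : nat) (a : R) (v : 'cV[R]_n) : enorm (a *: v) = `|a| * enorm v.
Proof.
rewrite /enorm -sqrtr_sqr -sqrtrM ?sqr_ge0// mulr_sumr; congr Num.sqrt.
by apply: eq_bigr => i _; rewrite mxE exprMn.
Qed.

Lemma opnorm_le (m n : nat) (M : 'M[R]_(m, n)) (c : R) (v : 'cV[R]_n) :
  opnorm M <= c -> enorm (M *m v) <= c * enorm v.
Proof.
move=> Mc; have [v0|v0] := eqVneq (enorm v) 0.
  have -> : v = 0.
    by apply/eqP; rewrite -normr_le0 (le_trans (normv_le_enorm _))// v0.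
  have e0 (p : nat) : enorm (0 : 'cV[R]_p) = 0.
    by rewrite /enorm big1 ?sqrtr0// => i _; rewrite mxE expr0n.
  by rewrite mulmx0 !e0 mulr0.
have vp : 0 < enorm v by rewrite lt_def v0 enorm_ge0.
rewrite -ler_pdivrMr//; apply: le_trans Mc.
have -> : enorm (M *m v) / enorm v = enorm (M *m ((enorm v)^-1 *: v)).
  by rewrite -scalemxAr enormZ ger0_norm ?invr_ge0 1?ltW// mulrC.
apply: ub_le_sup; last first.
  exists ((enorm v)^-1 *: v) => //=.
  by rewrite enormZ normfV gtr0_norm// mulVf.
(* [sup] dominates its set only when that set is bounded above, which is checked here through the
   max norm. *)
have [a a0 ha] := mulmx_bounded M.
exists (m%:R * a) => _ [w /= w1 <-].
rewrite (le_trans (enorm_le_normv _))// ler_wpM2l//.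
by rewrite (le_trans (ha w))// ler_piMr// (le_trans (normv_le_enorm _)).
Qed.

Lemma sum_mul_le (n : nat) (v w : 'cV[R]_n) :
  `|\sum_i v i 0 * w i 0| <= n%:R * (`|v| * enorm w).
Proof.
rewrite (le_trans (ler_norm_sum _ _ _))//.
apply: (@le_trans _ _ (\sum_(i < n) `|v| * enorm w)); last first.
  by rewrite sumr_const card_ord mulr_natl.
apply: ler_sum => i _; rewrite normrM ler_pM ?normv_coord//.
by rewrite (le_trans (normv_coord _ _)) ?normv_le_enorm.
Qed.

Lemma col_sum (n : nat) (v : 'cV[R]_n) : v = \sum_i v i 0 *: delta_mx i 0.
Proof.
apply/colP => i; rewrite summxE (bigD1 i)//= !mxE !eqxx mulr1.
rewrite big1 ?addr0// => j ji; rewrite !mxE [i == j]eq_sym (negbTE ji).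
by rewrite mulr0.
Qed.

Lemma dirx_sum x : (x, 0) = \sum_i x i 0 *: dirx R k i :> 'cV[R]_d * 'cV[R]_k.
Proof.
rewrite [in LHS](col_sum x).
elim/big_ind2 : _ => // [a b a' b' <- <-|i _]; first by congr pair; rewrite addr0.
by congr pair; rewrite scaler0.
Qed.

Lemma diru_sum u : (0, u) = \sum_i u i 0 *: diru R d i :> 'cV[R]_d * 'cV[R]_k.
Proof.
rewrite [in LHS](col_sum u).
elim/big_ind2 : _ => // [a b a' b' <- <-|i _]; first by congr pair; rewrite addr0.
by congr pair; rewrite scaler0.
Qed.

Lemma derive_dirx (F : 'cV[R]_d * 'cV[R]_k -> R) x z : differentiable F z ->
  'D_(x, 0) F z = \sum_i x i 0 * 'D_(dirx R k i) F z.
Proof.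
by move=> dF; rewrite dirx_sum; exact: (derive_linear_sum (fun i => x i 0)).
Qed.

Lemma derive_diru (F : 'cV[R]_d * 'cV[R]_k -> R) u z : differentiable F z ->
  'D_(0, u) F z = \sum_i u i 0 * 'D_(diru R d i) F z.
Proof.
by move=> dF; rewrite diru_sum; exact: (derive_linear_sum (fun i => u i 0)).
Qed.

(** * Growth and Lipschitz bounds from second derivatives *)

Section C2_function.
Variables (f : 'cV[R]_d * 'cV[R]_k -> R) (C0 C1 C2 : R).
Hypotheses (f2 : is_C2 f) (C00 : 0 < C0) (C10 : 0 <= C1) (C20 : 0 <= C2).
Hypothesis fB : forall x u,
  [/\ loewner_le (C0^-1)%:M (hessuu f (x, u)),
      loewner_le (hessuu f (x, u)) C0%:M,
      opnorm (hessxu f (x, u)) <= C1 * (1 + enorm u) &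
      `|f (x, 0)| + enorm (gradx f (x, 0)) + enorm (gradu f (x, 0)) <= C2].

Let f1 z : differentiable f z. Proof. by case: f2 => -[]. Qed.

Let df1 v z : differentiable ('D_v f) z.
Proof. by case: f2 => _ /(_ v)[]. Qed.

Let pair_line x y u v (s : R) : (x, u) + s *: (y, v) = (x + s *: y, u + s *: v).
Proof. by []. Qed.

Let lipx0 x y : `|f (y, 0) - f (x, 0)| <= d%:R * C2 * `|y - x|.
Proof.
have [s _] := mean_value_line (x, 0) (y - x, 0 : 'cV[R]_k) f1.
have -> : (x, 0) + (y - x, 0) = (y, 0) :> 'cV[R]_d * 'cV[R]_k.
  by congr pair; rewrite ?addr0// addrC subrK.
move=> ->; rewrite pair_line scaler0 addr0 derive_dirx//.
rewrite (eq_bigr (fun i => (y - x) i 0 * gradx f (x + s *: (y - x), 0) i 0)).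
  rewrite (le_trans (sum_mul_le _ _))// -mulrA ler_wpM2l// mulrC ler_wpM2r//.
  have [_ _ _] := fB (x + s *: (y - x)) 0; apply: le_trans.
  by rewrite addrAC lerDr addr_ge0// enorm_ge0.
by move=> i _; rewrite [gradx _ _ _ _]mxE.
Qed.

Let Du u z : 'D_(0, u) f z = \sum_j u j 0 * 'D_(diru R d j) f z.
Proof. by rewrite diru_sum derive_linear_sum. Qed.

Let DDu w u z : 'D_w ('D_(0, u) f) z = \sum_j u j 0 * 'D_w ('D_(diru R d j) f) z.
Proof.
have -> : 'D_(0, u) f = \sum_j (u j 0 \*: 'D_(diru R d j) f).
  by apply/funext => z'; rewrite Du fct_sumE.
rewrite derive_sum => [|j]; last exact/derivableZ/diff_derivable.
by apply: eq_bigr => j _; rewrite deriveZ//; exact/diff_derivable.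
Qed.

Let hessuuE u z : 'D_(0, u) ('D_(0, u) f) z = (u^T *m hessuu f z *m u) 0 0.
Proof.
rewrite DDu mxE; apply: eq_bigr => j _.
rewrite mulrC derive_diru//; congr (_ * _).
by rewrite mxE; apply: eq_bigr => i _; rewrite !mxE.
Qed.

Let hessxuE x u z : 'D_(x, 0) ('D_(0, u) f) z =
  \sum_i x i 0 * (hessxu f z *m u) i 0.
Proof.
rewrite derive_dirx//; apply: eq_bigr => i _; congr (_ * _).
by rewrite DDu mxE; apply: eq_bigr => j _; rewrite mxE mulrC.
Qed.

Let quadE (a : R) u : (u^T *m a%:M *m u) 0 0 = a * enorm u ^+ 2.
Proof.
rewrite mul_mx_scalar -scalemxAl mxE sqr_enorm mxE; congr (_ * _).
by apply: eq_bigr => i _; rewrite mxE expr2.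
Qed.

Let is_derive_u u z (F : 'cV[R]_d * 'cV[R]_k -> R) (s : R) :
  (forall w, differentiable F w) ->
  is_derive s (1 : R) (fun r => F (z, r *: u)) ('D_(0, u) F (z, s *: u)).
Proof.
move=> dF; have E r : (z, 0) + r *: (0, u) = (z, r *: u) :> 'cV[R]_d * 'cV[R]_k.
  by rewrite pair_line scaler0 addr0 add0r.
have := is_derive_line (dF ((z, 0) + s *: (0, u))).
rewrite E (_ : (fun r => _) = (fun r => F (z, r *: u)))//.
by apply/funext => r; rewrite E.
Qed.

(** The derivative in [x] is controlled directly only at zero control. The difference of [f] at [y]
    and [x] is therefore followed along [s *: u]: its derivative in [s] is a difference of
    [u]-derivatives, and a second mean value theorem, now in [x], brings in the mixed Hessian, whose
    bound at [s *: u] is at most that at [u]. *)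
Lemma C2_lipx x y u : `|f (y, u) - f (x, u)| <=
  (d%:R * C2 + d%:R * C1 * ((1 + enorm u) * enorm u)) * `|y - x|.
Proof.
have dpsi s : is_derive s (1 : R) (fun s => f (y, s *: u) - f (x, s *: u))
    ('D_(0, u) f (y, s *: u) - 'D_(0, u) f (x, s *: u)).
  by apply: is_deriveB; exact: is_derive_u.
have [s s01] := mean_value_unit dpsi.
have [r _] := mean_value_line (x, s *: u) (y - x, 0 : 'cV[R]_k) (df1 (0, u)).
have -> : (x, s *: u) + (y - x, 0) = (y, s *: u) :> 'cV[R]_d * 'cV[R]_k.
  by congr pair; rewrite ?addr0// addrC subrK.
move=> ->; rewrite pair_line scaler0 addr0 hessxuE !scale1r !scale0r => h.
rewrite -[f (y, u) - _](subrK (f (y, 0) - f (x, 0))) h addrC mulrDl.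
rewrite (le_trans (ler_normD _ _))// lerD//.
rewrite (le_trans (sum_mul_le _ _))//.
rewrite (_ : d%:R * C1 * _ * _ =
  d%:R * (`|y - x| * (C1 * (1 + enorm u) * enorm u))); last by ring.
rewrite ler_wpM2l// ler_wpM2l//.
have [_ _ hxu _] := fB (x + r *: (y - x)) (s *: u).
rewrite (le_trans (opnorm_le u hxu))// ler_wpM2r ?enorm_ge0// ler_wpM2l//.
rewrite lerD2l enormZ; have /andP[s0 s1] := s01.
by rewrite ger0_norm// ler_piMl// enorm_ge0.
Qed.

Let slope x u (s : R) : 0 <= s ->
  C0^-1 * enorm u ^+ 2 * s <= 'D_(0, u) f (x, s *: u) - 'D_(0, u) f (x, 0)
    <= C0 * enorm u ^+ 2 * s.
Proof.
move=> s0; have [r _] := mean_value_line (x, 0) (0 : 'cV[R]_d, s *: u) (df1 (0, u)).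
have -> : (x, 0) + (0, s *: u) = (x, s *: u) :> 'cV[R]_d * 'cV[R]_k.
  by congr pair; rewrite ?addr0 ?add0r.
move=> ->; rewrite pair_line scaler0 addr0 add0r.
rewrite derive_diru//.
rewrite (eq_bigr (fun j =>
  s * (u j 0 * 'D_(diru R d j) ('D_(0, u) f) (x, r *: (s *: u))))); last first.
  by move=> j _; rewrite mxE mulrA.
rewrite -mulr_sumr -derive_diru// hessuuE.
have [h1 h2 _ _] := fB x (r *: (s *: u)).
have := h1 u; have := h2 u; rewrite !quadE => h3 h4.
by apply/andP; split; [rewrite [leLHS]mulrC|rewrite [leRHS]mulrC]; rewrite ler_wpM2l.
Qed.

Lemma C2_growth x u :
  C0^-1 / 2 * enorm u ^+ 2 - C2 - k%:R * C2 * enorm u <= f (x, u)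
    <= C0 / 2 * enorm u ^+ 2 + C2 + k%:R * C2 * enorm u.
Proof.
(* Second-order Taylor bound from the first-order mean value theorem: after subtracting the linear
   term and [c / 2 * s ^ 2], the derivative has a sign by [slope], with [c] the lower or the upper
   Hessian bound in the direction [u]. *)
have dphi c s : is_derive s (1 : R) (fun s : R => f (x, s *: u)
    - 'D_(0, u) f (x, 0) * s - c / 2 * s ^+ 2)
    ('D_(0, u) f (x, s *: u) - 'D_(0, u) f (x, 0) - c * s).
  have h := @is_derive_u u x f s f1.
  by apply: is_derive_eq; rewrite /GRing.scale/=; field.
have [_ _ _ hC] := fB x 0.
have f0 : `|f (x, 0)| <= C2.
  by apply: le_trans hC; rewrite -addrA lerDl addr_ge0// enorm_ge0.
have D0 : `|'D_(0, u) f (x, 0)| <= k%:R * C2 * enorm u.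
  have -> : 'D_(0, u) f (x, 0) = \sum_j u j 0 * gradu f (x, 0) j 0.
    by rewrite Du; apply: eq_bigr => j _; rewrite [gradu _ _ _ _]mxE.
  apply: (le_trans (sum_mul_le _ _)); rewrite -mulrA ler_wpM2l// mulrC.
  apply: ler_pM; rewrite ?enorm_ge0// ?normv_le_enorm//.
  by apply: le_trans hC; rewrite lerDr addr_ge0// enorm_ge0.
move: f0 D0; rewrite !ler_norml => /andP[a1 a2] /andP[a3 a4].
apply/andP; split.
  have [s /andP[s0 _]] := mean_value_unit (dphi (C0^-1 * enorm u ^+ 2)).
  rewrite !scale1r !scale0r => h; have /andP[h1 _] := slope x u s0.
  by move: h1 h; nra.
have [s /andP[s0 _]] := mean_value_unit (dphi (C0 * enorm u ^+ 2)).
rewrite !scale1r !scale0r => h; have /andP[_ h1] := slope x u s0.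
by move: h1 h; nra.
Qed.

End C2_function.
End cost_estimates.

(** * Bounds on the running cost along a flow of measures *)

Section cost_bounds.
Variables (R : realType) (d k : nat).
Local Notation E := (borel 'cV[R]_d).
Variables (T : R) (m : R -> probability E R).
Variable L : 'cV[R]_d -> 'cV[R]_k -> probability E R -> R.
Hypothesis m1 : forall s, 0 <= s <= T -> finite_moment 1 (m s).

(** Take [lambda = 1/2] and a ball large enough for both outer points; [w] is the same for all
    balls, so the result is global. The factor [d ^ 2] pays for passing to the max norm. *)
Lemma midpoint_semiconcave (w : R) (g : 'cV[R]_d -> R) : 0 <= w ->
  (forall lambda r : R, 0 <= lambda <= 1 -> 0 < r -> forall x0 x1,
    enorm x0 < r -> enorm x1 < r ->
    lambda * g x0 + (1 - lambda) * g x1 - g (lambda *: x0 + (1 - lambda) *: x1)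
      <= w * lambda * (1 - lambda) * enorm (x0 - x1) ^+ 2) ->
  forall x y, g (x + y) + g (x - y) - 2 * g x
    <= 2 * w * d%:R ^+ 2 * `|y| ^+ 2.
Proof.
move=> w0 gw x y.
have l01 : 0 <= (2^-1 : R) <= 1 by apply/andP; split; lra.
have r0 : 0 < enorm (x + y) + enorm (x - y) + 1.
  by rewrite ltr_wpDl// addr_ge0// enorm_ge0.
have := gw _ _ l01 r0 (x + y) (x - y).
have -> : 2^-1 *: (x + y) + (1 - 2^-1) *: (x - y) = x.
  by apply/colP => i; rewrite !mxE; field.
have -> : x + y - (x - y) = 2 *: y by apply/colP => i; rewrite !mxE; ring.
rewrite enormZ exprMn ger0_norm// => h.
have ey : enorm y ^+ 2 <= d%:R ^+ 2 * `|y| ^+ 2.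
  by rewrite -exprMn lerXn2r ?nnegrE ?enorm_ge0 ?mulr_ge0 ?enorm_le_normv.
have hw : w * enorm y ^+ 2 <= w * (d%:R ^+ 2 * `|y| ^+ 2) by rewrite ler_wpM2l.
have h1 : enorm (x + y) < enorm (x + y) + enorm (x - y) + 1.
  by rewrite -addrA ltrDl ltr_wpDl// enorm_ge0.
have h2 : enorm (x - y) < enorm (x + y) + enorm (x - y) + 1.
  by rewrite addrAC ltrDr ltr_wpDl// enorm_ge0.
by move: (h h1 h2) hw; lra.
Qed.

Lemma derive_col (n : nat) (g : 'cV[R]_n -> R) v z : differentiable g z ->
  'D_v g z = \sum_i v i 0 * 'D_(delta_mx i 0) g z.
Proof.
by move=> dg; rewrite [in LHS](col_sum v); exact: (derive_linear_sum (fun i => v i 0)).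
Qed.

Lemma C1b_lipschitz (g : 'cV[R]_d -> R) : is_C1b g ->
  exists2 K : R, 0 <= K & forall x y, `|g x - g y| <= K * `|x - y|.
Proof.
case=> -[g1 _] _ [M hM] _; have M0 : 0 <= M by apply: le_trans (hM 0); exact: enorm_ge0.
exists (d%:R * M) => [|x y]; first by rewrite mulr_ge0.
have [s _] := mean_value_line y (x - y) g1.
rewrite [y + _]addrC subrK => ->.
have -> : 'D_(x - y) g (y + s *: (x - y)) =
    \sum_i (x - y) i 0 * grad g (y + s *: (x - y)) i 0.
  rewrite derive_col//; apply: eq_bigr => i _.
  by rewrite [grad _ _ _ _]mxE.
apply: (le_trans (sum_mul_le _ _)); rewrite -mulrA ler_wpM2l// mulrC.
by rewrite ler_wpM2r.
Qed.

(** The Lipschitz property of the flow enters through the time variable: composed with the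
    [d1]-Lipschitz dependence of [L] it gives the constant [K * Km] in time. *)
Lemma running_boundsP (Km wL : R) : running_cost_assumptions L -> 0 <= Km ->
  (forall s r, 0 <= s <= T -> 0 <= r <= T -> s != r ->
    (d1 (m s) (m r) <= (Km * `|s - r|)%:E)%E) ->
  0 <= wL ->
  (forall s, 0 <= s <= T -> forall u x y,
    L (x + y) u (m s) + L (x - y) u (m s) - 2 * L x u (m s)
      <= wL * `|y| ^+ 2) ->
  exists C c, [/\ 0 <= C, 0 < c &
    running_bounds T C c (fun s x u => L x u (m s))].
Proof.
move=> [hC2 [K K0 hK] [C0 [C1 [C2 [C00 C10 C20 hB]]]]] Km0 hd w0 hw.
(* [Ca] serves the growth bound, [Cb] the coercivity and [Cc] the Lipschitz bound in [x]; the factor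
   [2] in [Cc] comes from [(1 + U) * U <= 2 * (1 + U ^ 2)]. *)
pose Ca := C2 + k%:R * C2 + C0.
pose Cb := C2 + (k%:R * C2) ^+ 2 * C0.
pose Cc := d%:R * C2 + 2 * (d%:R * C1).
have kC2 : 0 <= k%:R * C2 by rewrite mulr_ge0.
have dC1 : 0 <= d%:R * C1 by rewrite mulr_ge0.
have dC2 : 0 <= d%:R * C2 by rewrite mulr_ge0.
have Ca0 : 0 <= Ca by rewrite /Ca !addr_ge0// ltW.
have Cb0 : 0 <= Cb by rewrite /Cb addr_ge0// mulr_ge0 ?sqr_ge0// ltW.
have Cc0 : 0 <= Cc by rewrite /Cc addr_ge0// mulr_ge0.
have KK0 : 0 <= K * Km by rewrite mulr_ge0.
have ci : 0 < C0^-1 by rewrite invr_gt0.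
have [Ct [Ct0 CaC CbC CcC [CkC CwC]]] : exists Ct, [/\ 0 <= Ct, Ca <= Ct, Cb <= Ct,
    Cc <= Ct & K * Km <= Ct /\ wL <= Ct].
  by exists (Ca + Cb + Cc + K * Km + wL); repeat split; lra.
exists Ct, (C0^-1 / 4); split=> //.
  by rewrite divr_gt0.
have growth (s : R) x u (sT : 0 <= s <= T) := C2_growth (hC2 _ (m1 sT))
  (fun x u => hB x u _ (m1 sT)) x u.
have lipx (s : R) x y u (sT : 0 <= s <= T) := C2_lipx (hC2 _ (m1 sT)) C10
  (fun x u => hB x u _ (m1 sT)) x y u.
split.
- move=> s x u sT; have /= := growth s x u sT; move: (L x u (m s)) => f.
  have := enorm_ge0 u; move: (enorm u) => U U0 /andP[h1 h2].
  apply: (@le_trans _ _ (Ca * (1 + U ^+ 2))); last first.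
    by rewrite ler_wpM2r ?addr_ge0 ?sqr_ge0.
  have U1 : U <= 1 + U ^+ 2 by nra.
  have hU : k%:R * C2 * U <= k%:R * C2 * (1 + U ^+ 2) by rewrite ler_wpM2l.
  have hC0 := ltW C00.
  have := mulr_ge0 C20 (sqr_ge0 U); have := mulr_ge0 (ltW C00) (sqr_ge0 U).
  have := mulr_ge0 (ltW ci) (sqr_ge0 U); rewrite /Ca ler_norml => ? ? ?.
  by apply/andP; split; lra.
- move=> s x u sT; have /= := growth s x u sT; move: (L x u (m s)) => f.
  have := enorm_ge0 u; move: (enorm u) => U U0 /andP[h1 _].
  apply: le_trans h1.
  (* Half of the quadratic growth absorbs the linear term by completing the square, which leaves the
     coefficient [C0^-1 / 4] and the constant in [Cb]. *)
  have : 0 <= C0^-1 / 4 * (U - 2 * C0 * (k%:R * C2)) ^+ 2.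
    by rewrite mulr_ge0 ?sqr_ge0// divr_ge0// ltW.
  have -> : C0^-1 / 4 * (U - 2 * C0 * (k%:R * C2)) ^+ 2 =
      C0^-1 / 4 * U ^+ 2 - k%:R * C2 * U + (k%:R * C2) ^+ 2 * C0.
    by field; rewrite gt_eqF.
  by rewrite /Cb in CbC; lra.
- move=> s x y u sT; have /= := lipx s y x u sT; move/le_trans; apply.
  rewrite ler_wpM2r//; have := enorm_ge0 u; move: (enorm u) => U U0.
  apply: (@le_trans _ _ (Cc * (1 + U ^+ 2))); last first.
    by rewrite ler_wpM2r ?addr_ge0 ?sqr_ge0.
  have U1 : (1 + U) * U <= 2 * (1 + U ^+ 2) by nra.
  have := mulr_ge0 dC2 (sqr_ge0 U).
  have : d%:R * C1 * ((1 + U) * U) <= d%:R * C1 * (2 * (1 + U ^+ 2)).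
    by rewrite ler_wpM2l.
  by rewrite /Cc; lra.
- move=> s r x u sT rT; have [->|sr] := eqVneq s r.
    by rewrite !subrr !normr0 mulr0.
  apply: (@le_trans _ _ (K * Km * `|s - r|)); last first.
    by rewrite ler_wpM2r.
  rewrite -lee_fin; apply: (le_trans (hK x u _ _ (m1 sT) (m1 rT))).
  rewrite -mulrA EFinM lee_wpmul2l ?lee_fin//.
  exact: hd.
- move=> s x y u sT; apply: (le_trans (hw s sT u x y)).
  by rewrite ler_wpM2r ?sqr_ge0.
- move=> s x sT u.
  have cf : {for (x, u), continuous (fun z => L z.1 z.2 (m s))}.
    apply: differentiable_continuous.
    by case: (hC2 _ (m1 sT)) => -[].
  have cp : (fun v : 'cV[R]_k => (x, v)) @ nbhs u --> (x, u).
    exact: (@cvg_pair _ _ _ (nbhs u) (nbhs x) (nbhs u) _ _ _ (fun=> x) id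
      (cvg_cst _) cvg_id).
  exact: (cvg_comp (fun v : 'cV[R]_k => (x, v)) (fun z => L z.1 z.2 (m s)) cp cf).
Qed.

End cost_bounds.

(** * Moments along the flow *)

Section moments.
Variables (R : realType) (d : nat).
Local Notation E := (borel 'cV[R]_d).
Implicit Types m : probability E R.
Local Open Scope ereal_scope.

Lemma measurable_coord (i : 'I_d) :
  measurable_fun [set: E] (fun x : E => (x : 'cV[R]_d) i ord0).
Proof.
apply: (measurability _ (RGenOpens.measurableE R)).
move=> _ [_ [a [b ->] <-]]; rewrite setTI; apply: sub_sigma_algebra.
apply: open_comp; last exact: interval_open.
by move=> x _; exact: coord_continuous.
Qed.

Lemma measurable_enorm_comp (disp : measure_display) (X : measurableType disp)
    (n : nat) (w : X -> 'cV[R]_n) :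
  (forall i, measurable_fun [set: X] (fun x => w x i ord0)) ->
  measurable_fun [set: X] (fun x => enorm (w x)).
Proof.
move=> mw; rewrite (_ : (fun x => _) =
    Num.sqrt \o (fun x => \sum_i w x i ord0 ^+ 2)%R)//.
apply: measurableT_comp.
  by apply: continuous_measurable_fun; exact: sqrt_continuous.
by apply: measurable_sum => i; exact: measurable_funX.
Qed.

Lemma measurable_enorm : measurable_fun [set: E] (fun x : E => enorm (x : 'cV[R]_d)).
Proof. by apply: measurable_enorm_comp => i; exact: measurable_coord. Qed.

Lemma moment1E m : moment 1 m = \int[m]_x (enorm x)%:E.
Proof. by apply: eq_integral => x _; rewrite powRr1// enorm_ge0. Qed.

(** Pointwise [|x| <= 1 + |x| ^ p], and [m] has mass one. *)
Lemma finite_moment_le (p : R) m : (1 <= p)%R -> finite_moment p m ->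
  finite_moment 1 m.
Proof.
move=> p1; rewrite /finite_moment moment1E => mp.
have mP : measurable_fun [set: E] (fun x : E => (enorm x `^ p)%R).
  apply: (@measurableT_comp _ _ _ _ _ _ (fun r : R => (r `^ p)%R)).
    exact: measurable_powR.
  exact: measurable_enorm.
apply: (@le_lt_trans _ _ (\int[m]_x (1 + (enorm x `^ p)%:E))).
  apply: ge0_le_integral => //.
  - by move=> x _; rewrite lee_fin enorm_ge0.
  - by apply/measurable_EFinP; exact: measurable_enorm.
  - by apply: emeasurable_funD => //; exact/measurable_EFinP.
  - move=> x _; rewrite -EFinD lee_fin.
    have [e1|e1] := leP (enorm x) 1%R; first by rewrite ler_wpDr// powR_ge0.
    rewrite ler_wpDl// -{1}[enorm x]powRr1 ?enorm_ge0//.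
    by rewrite ler_powR// ltW.
rewrite ge0_integralD//.
- have -> : \int[m]_(x in [set: E]) 1 = 1.
    by rewrite integral_cst// mul1e; exact: probability_setT.
  by rewrite lte_add_pinfty// ltry.
- by move=> x _; rewrite lee_fin powR_ge0.
- by apply/measurable_EFinP.
Qed.

(** A finite distance provides a coupling of finite cost, under which [|x|] is bounded by a multiple
    of [|x - y| + |y|]. This carries the finite first moment from the initial measure to every
    measure of a Lipschitz flow. *)
Lemma finite_moment_d1 m m' : finite_moment 1 m' -> d1 m m' < +oo ->
  finite_moment 1 m.
Proof.
rewrite /finite_moment !moment1E => fm' /ereal_inf_lt[_ [pi cpi <-] fpi].
have mfst : measurable_fun setT (fst : E * E -> E) by exact: measurable_fst.
have msnd : measurable_fun setT (snd : E * E -> E) by exact: measurable_snd.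
have me : measurable_fun [set: E] (fun x : E => (enorm (x : 'cV[R]_d))%:E).
  by apply/measurable_EFinP; exact: measurable_enorm.
have E1 : \int[m]_x (enorm x)%:E = \int[pi]_z (enorm z.1)%:E.
  transitivity (\int[pushforward pi (fst : E * E -> E)]_x (enorm x)%:E).
    apply: eq_measure_integral => D mD _.
    have [h _] := cpi D mD; apply: (etrans (esym h)); congr (pi _).
    by apply/seteqP; split=> z //= [].
  rewrite ge0_integral_pushforward//.
  by move=> x _; rewrite lee_fin enorm_ge0.
have E2 : \int[m']_x (enorm x)%:E = \int[pi]_z (enorm z.2)%:E.
  transitivity (\int[pushforward pi (snd : E * E -> E)]_x (enorm x)%:E).
    apply: eq_measure_integral => D mD _.
    have [_ h] := cpi D mD; apply: (etrans (esym h)); congr (pi _).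
    by apply/seteqP; split=> z //= [].
  rewrite ge0_integral_pushforward//.
  by move=> x _; rewrite lee_fin enorm_ge0.
have mc1 i : measurable_fun setT (fun z : E * E => (z.1 : 'cV[R]_d) i ord0).
  by apply: (measurableT_comp (measurable_coord i)).
have mc2 i : measurable_fun setT (fun z : E * E => (z.2 : 'cV[R]_d) i ord0).
  by apply: (measurableT_comp (measurable_coord i)).
have m2 : measurable_fun setT (fun z : E * E => (enorm (z.2 : 'cV[R]_d))%:E).
  by apply/measurable_EFinP; exact: measurable_enorm_comp.
have m1 : measurable_fun setT (fun z : E * E => (enorm (z.1 : 'cV[R]_d))%:E).
  by apply/measurable_EFinP; exact: measurable_enorm_comp.
have m12 : measurable_fun setT (fun z : E * E => (enorm (z.1 - z.2 : 'cV[R]_d)%R)%:E).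
  apply/measurable_EFinP; apply: measurable_enorm_comp => i.
  under eq_fun do rewrite !mxE.
  exact: measurable_funB.
rewrite E1; apply: (@le_lt_trans _ _
  (\int[pi]_z (d%:R%:E * ((enorm (z.1 - z.2)%R)%:E + (enorm z.2)%:E)))).
  apply: ge0_le_integral => //.
  - by move=> x _; rewrite lee_fin enorm_ge0.
  - by apply: measurable_funeM; exact: emeasurable_funD.
  (* The triangle inequality is taken in the max norm, hence the factor [d]. *)
  - move=> z _; rewrite -EFinD -EFinM lee_fin (le_trans (enorm_le_normv _))//.
    rewrite ler_wpM2l// -[X in `|X|%R](subrK z.2) (le_trans (ler_normD _ _))//.
    by rewrite lerD// normv_le_enorm.
rewrite ge0_integralZl//; first last.
- by move=> z _; rewrite adde_ge0// lee_fin enorm_ge0.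
- exact: emeasurable_funD.
rewrite ge0_integralD//; first last.
- by move=> z _; rewrite lee_fin enorm_ge0.
- by move=> z _; rewrite lee_fin enorm_ge0.
rewrite -E2 lte_mul_pinfty ?lee_fin//.
by rewrite lte_add_pinfty.
Qed.

End moments.

(** * Semiconcavity of the value function *)

Section value_function.
Variables (R : realType) (d k : nat) (A : 'M[R]_d) (B : 'M[R]_(d, k)).
Variables (T C c : R) (l : R -> 'cV[R]_d -> 'cV[R]_k -> R) (G : 'cV[R]_d -> R).
Variables (T0 : 0 <= T) (C0 : 0 <= C) (c0 : 0 < c).
Variables (hl : running_bounds T C c l) (hG : terminal_bounds C G).

Definition payoffs (t : R) (x : 'cV[R]_d) : set R :=
  [set z | exists u g, admissible_pair A B T t x u g /\ z = payoff T l G t g u].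

(** The real-valued [inf] is meaningful only for a nonempty set bounded below: the zero control
    gives the first, coercivity the second. *)
Lemma payoffs_has_inf t x : 0 <= t <= T -> has_inf (payoffs t x).
Proof.
move=> tT; split.
  have [p [ap _]] := zero_admissible A B T0 C0 hl hG x tT.
  by exists (payoff T l G t p (fun=> 0)), (fun=> 0), p.
exists (- (C * (T - t)) - C) => _ [u [g [ad ->]]].
apply: le_trans (payoff_lower T0 C0 hl hG tT ad).
rewrite lerD2r -[leLHS]add0r lerD2r; apply: mulr_ge0; first exact: ltW.
by apply: int_ge0 => s _; exact: sqr_ge0.
Qed.

Lemma inf_payoffs_semiconcave (rho : R) : 0 < rho -> exists2 La : R, 0 <= La &
  forall t delta x h, 0 <= t <= T -> enorm x <= rho ->
    0 <= t + delta <= T -> enorm (x + h) <= rho ->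
    0 <= t - delta <= T -> enorm (x - h) <= rho ->
    inf (payoffs (t + delta) (x + h)) + inf (payoffs (t - delta) (x - h))
      - 2 * inf (payoffs t x) <= La * (enorm h ^+ 2 + delta ^+ 2).
Proof.
(* The largest possible [e]: both [x] and [x + h] lie in the ball of radius [rho], so the max norm
   of [h] is at most [2 * rho], and [|delta| <= T]. *)
move=> rho0; pose e0 := (d%:R * (2 * rho)) ^+ 2 + T ^+ 2.
have e00 : 0 <= e0 by rewrite addr_ge0// sqr_ge0.
have [La La0 hLa] := near_minimizer_semiconcave A B T0 C0 c0 hl hG e00 (ltW rho0).
(* The [2] pays for the [e]-optimality at the centre, which is counted twice; the factor
   [3 * (1 + e0)] comes from [sg] below. *)
exists (2 + La * (3 * (1 + e0))); first by rewrite addr_ge0// !mulr_ge0// addr_ge0.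
(* Replacing [(delta, h)] by its opposite exchanges the two outer points. *)
move=> t delta x h tT xr; wlog d0 : delta h / 0 <= delta => [hw|].
  have [d0|d0] := leP 0 delta; first exact: hw.
  move=> t1 x1 t2 x2; have := hw (- delta) (- h); rewrite !opprK sqrrN.
  have -> : enorm (- h) = enorm h by rewrite -scaleN1r enormZ normrN1 mul1r.
  rewrite [inf (payoffs (t - delta) _) + _]addrC; apply=> //.
  by rewrite oppr_ge0 ltW.
move=> /andP[_ tdT] xh /andP[td0 _] _.
set e := enorm h ^+ 2 + delta ^+ 2.
have e_ge0 : 0 <= e by rewrite addr_ge0 ?sqr_ge0.
have ee0 : e <= e0.
  apply: lerD.
    have r0 := ltW rho0; rewrite lerXn2r ?nnegrE ?enorm_ge0 ?mulr_ge0//.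
    apply: (le_trans (enorm_le_normv _)); rewrite ler_wpM2l//.
    rewrite -[h](addKr x) addrC (le_trans (ler_normB _ _))//.
    by rewrite mulr2n mulrDl mul1r lerD// (le_trans (normv_le_enorm _)).
  rewrite lerXn2r ?nnegrE//; case/andP: tT => t0 _.
  by apply: le_trans tdT; rewrite lerDr.
(* An [e]-optimal control exists only for positive [e]; if [e = 0], the three points coincide and
   the second difference vanishes. *)
have [e_0|e_gt0] := eqVneq e 0.
  have h0 : h = 0.
    apply/eqP; rewrite -normr_le0 (le_trans (normv_le_enorm _))//.
    rewrite -(@ler_sqr _ (enorm h)) ?nnegrE ?enorm_ge0// expr0n/=.
    by rewrite -[leRHS]e_0 lerDl sqr_ge0.
  have delta0 : delta = 0.
    by apply/eqP; rewrite -sqrf_eq0 eq_le sqr_ge0 andbT -[leRHS]e_0 lerDr sqr_ge0.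
  rewrite e_0 mulr0 h0 delta0 !addr0 !subr0.
  by rewrite [X in X - _ <= _](_ : _ = 2 * inf (payoffs t x)) ?subrr//; ring.
have {}e_gt0 : 0 < e by rewrite lt_def e_gt0.
have [_ [u [g [ad ->]]] hinf] := inf_adherent e_gt0 (payoffs_has_inf x tT).
have nm : near_minimizer A B T l G e t x u g.
  split=> // u' g' ad'; apply: (le_trans (ltW hinf)); rewrite lerD2r.
  apply: ge_inf; first by case: (payoffs_has_inf x tT).
  by exists u', g'.
have xr' : `|x| <= rho by rewrite (le_trans (normv_le_enorm _)).
have ein : 0 <= e <= e0 by rewrite e_ge0.
have [up [gp [um [gm [adp adm hpay]]]]] := hLa e t delta x h u g ein d0 td0 tdT xr' nm.
have /andP[t0 tT'] := tT.
have infp : inf (payoffs (t + delta) (x + h)) <= payoff T l G (t + delta) gp up.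
  apply: ge_inf; last by exists up, gp.
  by have [] := @payoffs_has_inf (t + delta) (x + h); rewrite ?addr_ge0.
have infm : inf (payoffs (t - delta) (x - h)) <= payoff T l G (t - delta) gm um.
  apply: ge_inf; last by exists um, gm.
  have [] := @payoffs_has_inf (t - delta) (x - h) => //.
  by rewrite td0 (le_trans _ tT')// lerBlDr lerDl.
(* The terms [|h| ^ 2] and [delta ^ 2] add up to at most [e], and the remaining [e ^ 2] is at most
   [e0 * e]. *)
have sg : (`|h| + delta + e) ^+ 2 <= 3 * (1 + e0) * e.
  have h2 : `|h| ^+ 2 <= enorm h ^+ 2.
    by rewrite lerXn2r ?nnegrE ?enorm_ge0// normv_le_enorm.
  have h3 : (`|h| + delta + e) ^+ 2 <= 3 * (`|h| ^+ 2 + delta ^+ 2 + e ^+ 2).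
    rewrite -subr_ge0.
    have -> : 3 * (`|h| ^+ 2 + delta ^+ 2 + e ^+ 2) - (`|h| + delta + e) ^+ 2 =
      (`|h| - delta) ^+ 2 + (`|h| - e) ^+ 2 + (delta - e) ^+ 2 by ring.
    by rewrite !addr_ge0// sqr_ge0.
  apply: (le_trans h3); rewrite -mulrA ler_wpM2l// mulrDl mul1r lerD//.
    by rewrite /e lerD2r.
  by rewrite expr2 ler_wpM2r.
have hsg : La * (`|h| + delta + e) ^+ 2 <= La * (3 * (1 + e0) * e).
  by rewrite ler_wpM2l.
have -> : (2 + La * (3 * (1 + e0))) * e = 2 * e + La * (3 * (1 + e0) * e) by ring.
by move: hsg hpay infp infm (ltW hinf); lra.
Qed.

End value_function.

Theorem corollary5p10 (R : realType) (d k : nat)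
  (A : 'M[R]_d) (B : 'M[R]_(d, k)) (T : R)
  (L : 'cV[R]_d -> 'cV[R]_k -> probability (borel 'cV[R]_d) R -> R)
  (G : 'cV[R]_d -> probability (borel 'cV[R]_d) R -> R)
  (hT : 0 < T)
  (hL : running_cost_assumptions L)
  (hG : terminal_cost_assumptions G)
  (alpha : R) (halpha : 1 < alpha)
  (m0 : probability (borel 'cV[R]_d) R) (hm0 : finite_moment alpha m0)
  (R0 Rad : R) (hR0 : is_radius_threshold A B T L G alpha m0 R0)
  (hRad : R0 <= Rad)
  (wL wG : R) (hwL : 0 <= wL) (hwG : 0 <= wG)
  (hLsc : forall lambda r : R, 0 <= lambda <= 1 -> 0 < r ->
     forall (u : 'cV[R]_k) (x0 x1 : 'cV[R]_d)
       (m : probability (borel 'cV[R]_d) R),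
     enorm x0 < r -> enorm x1 < r -> finite_moment 1 m ->
     lambda * L x0 u m + (1 - lambda) * L x1 u m
       - L (lambda *: x0 + (1 - lambda) *: x1) u m
     <= wL * lambda * (1 - lambda) * enorm (x0 - x1) ^+ 2)
  (hGsc : forall lambda r : R, 0 <= lambda <= 1 -> 0 < r ->
     forall (x0 x1 : 'cV[R]_d) (m : probability (borel 'cV[R]_d) R),
     enorm x0 < r -> enorm x1 < r -> finite_moment 1 m ->
     lambda * G x0 m + (1 - lambda) * G x1 m
       - G (lambda *: x0 + (1 - lambda) *: x1) m
     <= wG * lambda * (1 - lambda) * enorm (x0 - x1) ^+ 2)
  (eta : probability (borel (Gamma A B T)) R)
  (heta : is_equilibrium L G alpha m0 Rad eta)
  (heta_lip : lipschitz_flow eta)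
  (V : R -> 'cV[R]_d -> R) (m : R -> probability (borel 'cV[R]_d) R)
  (hV : (V, m) = mild_solution L G eta) :
  forall rho : R, 0 < rho -> exists2 Lambda : R, 0 <= Lambda &
    forall (t delta : R) (x h : 'cV[R]_d),
      0 <= t <= T -> enorm x <= rho ->
      0 <= t + delta <= T -> enorm (x + h) <= rho ->
      0 <= t - delta <= T -> enorm (x - h) <= rho ->
      V (t + delta) (x + h) + V (t - delta) (x - h) - 2 * V t x
        <= Lambda * (enorm h ^+ 2 + delta ^+ 2).

Proof.
have [[hadm hmarg] _] := heta.
pose mt := flow eta.
have alpha1 : 1 <= alpha := ltW halpha.
have T0 : 0 <= T := ltW hT.
have in0T s : (s \in `[0, T]) = (0 <= s <= T) by rewrite in_itv.
have m10 : finite_moment 1 (mt 0).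
  apply: (finite_moment_le alpha1); move: hm0; rewrite /finite_moment.
  apply: le_lt_trans; rewrite le_eqVlt; apply/orP; left; apply/eqP.
  by apply: eq_measure_integral => D mD _; exact: hmarg.
have [K hK] := heta_lip.
have hd s r : 0 <= s <= T -> 0 <= r <= T -> s != r ->
    (d1 (mt s) (mt r) <= (`|K| * `|s - r|)%:E)%E.
  move=> sT rT sr; apply: (le_trans (hK s r _ _ sr)); rewrite ?in0T//.
  by rewrite lee_fin ler_wpM2r// ler_norm.
(* The costs are constrained only at measures with finite first moment. At time [0] the flow is
   [m0], and every later measure is at finite distance from it. *)
have m1 s : 0 <= s <= T -> finite_moment 1 (mt s).
  move=> sT; have [->//|s0] := eqVneq s 0.
  apply: finite_moment_d1 m10 _; apply: le_lt_trans (hd s 0 sT _ s0) (ltry _).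
  by rewrite lexx.
have TT : 0 <= T <= T by rewrite T0 lexx.
have [M hM] := terminal_bounded hG.
have [KG KG0 hKG] := C1b_lipschitz (terminal_C1b hG (m1 T TT)).
have M0 : 0 <= M by apply: le_trans (hM 0 _ m10); exact: normr_ge0.
have wL0 : 0 <= 2 * wL * d%:R ^+ 2 by rewrite !mulr_ge0// exprn_ge0.
have wG0 : 0 <= 2 * wG * d%:R ^+ 2 by rewrite !mulr_ge0// exprn_ge0.
have [C [c [C0 c0 hl]]] := running_boundsP m1 hL (normr_ge0 K) hd wL0
  (fun s sT u => midpoint_semiconcave hwL (fun lambda r hl hr x0 x1 e0 e1 =>
    hLsc lambda r hl hr u x0 x1 (mt s) e0 e1 (m1 s sT))).
have hsG := midpoint_semiconcave hwG (fun lambda r hl hr x0 x1 e0 e1 =>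
    hGsc lambda r hl hr x0 x1 (mt T) e0 e1 (m1 T TT)).
(* The running and the terminal bounds must share one constant; it is kept opaque behind the
   equation [M'E]. *)
have [M' M'E] : exists M', M' = C + M + KG + 2 * wG * d%:R ^+ 2 by eexists.
have hl' : running_bounds T M' c (fun s x u => L x u (mt s)).
  have CM : C <= M' by rewrite M'E -!addrA lerDl !addr_ge0.
  case: hl => h1 h2 h3 h4 h5 h6; split=> //.
  - move=> s x u sT; apply: (le_trans (h1 s x u sT)).
    by rewrite ler_wpM2r// addr_ge0// sqr_ge0.
  - by move=> s x u sT; apply: le_trans (h2 s x u sT); rewrite lerB.
  - move=> s x y u sT; apply: (le_trans (h3 s x y u sT)).
    by rewrite ler_wpM2r// ler_wpM2r// addr_ge0// sqr_ge0.
  - by move=> s r x u sT rT; apply: (le_trans (h4 s r x u sT rT)); rewrite ler_wpM2r.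
  - by move=> s x y u sT; apply: (le_trans (h5 s x y u sT)); rewrite ler_wpM2r ?sqr_ge0.
have hG' : terminal_bounds M' (G ^~ (mt T)).
  split=> [x|x y|x y].
  - by apply: (le_trans (hM x _ (m1 T TT))); rewrite M'E; lra.
  - by apply: (le_trans (hKG x y)); rewrite ler_wpM2r// M'E; lra.
  - by apply: (le_trans (hsG x y)); rewrite ler_wpM2r ?sqr_ge0// M'E; lra.
have M'0 : 0 <= M' by rewrite M'E !addr_ge0.
have VE t x : 0 <= t <= T -> V t x =
    inf (payoffs A B T (fun s x u => L x u (mt s)) (G ^~ (mt T)) t x).
  case: hV => -> _ /andP[t0 tT]; congr inf; apply/seteqP; split=> z /=.
    move=> [u [g [/is_controlP cu /(is_trajectoryP _ _ _ _ _ tT)[tg gx] ->]]].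
    by exists u, g.
  move=> [u [g [[cu tg gx] ->]]]; exists u, g; split=> //.
    exact/is_controlP.
  exact/is_trajectoryP.
move=> rho rho0.
have [La La0 hLa] := inf_payoffs_semiconcave A B T0 M'0 c0 hl' hG' rho0.
exists La => // t delta x h tT xr tdT xh tmT xmh.
by rewrite !VE//; exact: hLa.
Qed.
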